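(* Suppose that the Lie algebra $\mathfrak g$ of $G$ is simple, of any classical type ($A$, $B$, $C$ or $D$), and let $r\ge 1$. For integers $\rho,k,k'\geq 1$ define $$\mathcal M(\rho,k)=\{\lambda\in\mathbb C^k:\lambda_i^\rho\neq\lambda_j^\rho\ \text{ for } i\neq j\},$$ $$\mathcal M^\sharp(\rho,k)=\{\lambda\in\mathcal M(\rho,k):\lambda_i\neq 0\ \text{ for all } i\},$$ $$\mathcal M^{\sharp\sharp}(k,k')=\{(\lambda,\mu)\in\mathcal M^\sharp(2,k)\times\mathcal M(2,k'):\lambda_i^2\neq\mu_j^2\ \text{ for } 1\le i\le k,\ 1\le j\le k'\}.$$ Then any $r$-Galois-closed irregular type $\widehat Q$ determines three functions $(\rho,k)\mapsto\mu(\rho,k)$, $(\rho,k)\mapsto\mu^\sharp(\rho,k)$, $(k,k')\mapsto\mu^{\sharp\sharp}(k,k')$, with values in $\mathbb Z_{\geq0}$ and finite support, such that there is a homeomorphism $$\mathbf B_r(\widehat Q)\simeq\prod_{\rho,k,k'\geq1}\Bigl(\mathcal M(\rho,k)^{\mu(\rho,k)}\times\mathcal M^\sharp(\rho,k)^{\mu^\sharp(\rho,k)}\times\mathcal M^{\sharp\sharp}(k,k')^{\mu^{\sharp\sharp}(k,k')}\Bigr)$$ with the product topology on the right-hand side (each pair $(\rho,k)$, resp. $(k,k')$, contributing once). Moreover, one has $\mu^{\sharp\sharp}\neq0$ only for certain irregular types in type $D$.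
   Context: $G$ is a connected complex reductive algebraic group with maximal torus $T$, Lie algebras $\mathfrak t\subset\mathfrak g$, root system $\Phi\subset\mathfrak t^\vee$, Weyl group $W$; $\zeta_r=e^{2\pi\sqrt{-1}/r}$. An irregular type is $\widehat Q=\sum_{i=1}^sA_iw^{-i}$ with $A_i\in\mathfrak t$ ($w$ a formal variable), identified with $(A_1,\dots,A_s)\in\mathfrak t^s$ (complex topology); $s$ is its irregularity. An element $g\in W$ generates the $r$-Galois-orbit of $\widehat Q$ if $g(A_i)=\zeta_r^iA_i$ for all $i$; $\widehat Q$ is $r$-Galois-closed if such a $g$ exists. For $\alpha\in\Phi$ let $d_\alpha(\widehat Q)$ be the pole order in $w$ of $\sum_i\alpha(A_i)w^{-i}$ ($0$ if this vanishes). Two $r$-Galois-closed irregular types satisfy $\widehat Q\sim_r\widehat Q'$ if some $g\in W$ generates both of their $r$-Galois-orbits and $d_\alpha(\widehat Q)=d_\alpha(\widehat Q')$ for all $\alpha\in\Phi$. The space $\mathbf B_r(\widehat Q)\subset\mathfrak t^s$ is the topological space of all $\widehat Q'$ of irregularity at most $s$ with $\widehat Q'\sim_r\widehat Q$. *)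

(* Defs.v *)
From HB Require Import structures.
From mathcomp Require Import all_boot all_order all_algebra.
From mathcomp Require Import complex.
From mathcomp Require Import all_classical all_reals all_analysis.

Set Implicit Arguments.
Unset Strict Implicit.
Unset Printing Implicit Defensive.

Import Order.TTheory GRing.Theory Num.Theory.

Local Open Scope classical_set_scope.
Local Open Scope ring_scope.
Local Open Scope complex_scope.

Definition homeomorphic (X Y : topologicalType) : Prop :=
  exists (f : X -> Y) (f' : Y -> X),
    [/\ continuous f, continuous f', cancel f f' & cancel f' f].

Section LieAlgebra.
Context {F : fieldType} {g : vectType F}.

Definition lie_bracket (br : g -> g -> g) : Prop :=
  [/\ forall x a y z, br x (a *: y + z) = a *: br x y + br x z,
      forall x a y z, br (a *: y + z) x = a *: br y x + br z x,
      forall x, br x x = 0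
    & forall x y z, br x (br y z) + br y (br z x) + br z (br x y) = 0].

Definition lie_simple (br : g -> g -> g) : Prop :=
  (exists x y, br x y != 0) /\
  forall I : {vspace g},
    (forall x y, y \in I -> br x y \in I) -> I = 0%VS \/ I = fullv.

(* Self-centralising, simultaneously ad-diagonalisable subalgebras: in a
   semisimple complex Lie algebra these are exactly the Lie algebras of the
   maximal tori. *)
Definition cartan_subalgebra (br : g -> g -> g) (t : {vspace g}) : Prop :=
  [/\ forall h h', h \in t -> h' \in t -> br h h' = 0,
      forall x, (forall h, h \in t -> br h x = 0) -> x \in t
    & exists2 b : seq g, basis_of fullv b &
        forall h x, h \in t -> x \in b -> exists c : F, br h x = c *: x].

Definition lie_roots (br : g -> g -> g) (t : {vspace g}) :
    set 'Hom(subvs_of t, F^o) :=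
  [set a | a != 0 /\ exists2 x : g, x != 0 &
     forall h : subvs_of t, br (vsval h) x = (a h : F) *: x].

End LieAlgebra.
Arguments lie_roots {F g} br t _.

Section RootSystem.
Context {F : fieldType} {T : vectType F}.
Implicit Types (Phi : set 'Hom(T, F^o)) (a b : 'Hom(T, F^o)).

(* The vector [ha] is the coroot of [a]; the stability of [Phi] makes it
   unique when [Phi] is a root system. *)
Definition root_reflection Phi a (s : 'End(T)) : Prop :=
  (exists ha : T, a ha = 2%:R /\ forall h, s h = h - (a h : F) *: ha) /\
  forall b, Phi b -> Phi (b \o s)%VF.

(* Closure under inverses is automatic, reflections being involutions. *)
Inductive weyl Phi : 'End(T) -> Prop :=
| weyl_id : weyl Phi \1%VF
| weyl_refl a s w : Phi a -> root_reflection Phi a s -> weyl Phi w ->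
    weyl Phi (s \o w)%VF.

Inductive classical_type := TypeA | TypeB | TypeC | TypeD.

Definition ncoord (X : classical_type) (n : nat) : nat :=
  if X is TypeA then n.+1 else n.

(* The ranks for which the root system X_n is irreducible; the low-rank
   coincidences such as B_2 = C_2 and A_3 = D_3 are all allowed. *)
Definition simple_rank (X : classical_type) (n : nat) : bool :=
  if X is TypeD then (2 < n)%N else (0 < n)%N.

Definition classical_root (X : classical_type) (N : nat)
    (e : 'I_N -> 'Hom(T, F^o)) a : Prop :=
  let typeD_root := exists (i j : 'I_N) (u v : bool),
    i != j /\ a = (-1) ^+ u *: e i + (-1) ^+ v *: e j in
  match X with
  | TypeA => exists i j : 'I_N, i != j /\ a = e i - e j
  | TypeB => typeD_root \/ exists (i : 'I_N) (u : bool), a = (-1) ^+ u *: e i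
  | TypeC => typeD_root \/
      exists (i : 'I_N) (u : bool), a = ((-1) ^+ u * 2%:R) *: e i
  | TypeD => typeD_root
  end.

(* [e] is the system of standard coordinates: it identifies [T] with F^n, or,
   in type A, with the hyperplane of F^(n+1) where the coordinates sum to 0. *)
Definition of_classical_type (X : classical_type) (n : nat) Phi : Prop :=
  simple_rank X n /\
  exists e : 'I_(ncoord X n) -> 'Hom(T, F^o),
    [/\ X = TypeA -> forall h : T, \sum_i (e i h : F) = 0,
        forall x : 'I_(ncoord X n) -> F, (X = TypeA -> \sum_i x i = 0) ->
          exists! h : T, forall i, e i h = x i
      & forall a, Phi a <-> classical_root X e a].

End RootSystem.

(* [T] with its complex topology, characterised as the coarsest one for which
   all linear forms are continuous (any basis of [T] gives a homeomorphism with
   C^(\dim T)). *)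
Definition complex_space (R : realType) (T : vectType R[i]) : topologicalType :=
  initial_topology (fun h : T =>
    (fun a => a h) : prod_topology (fun _ : 'Hom(T, R[i]^o) => R[i]^o)).

Section IrregularTypes.
Context {R : realType} {T : vectType R[i]}.
Variable Phi : set 'Hom(T, R[i]^o).

Definition zeta (r : nat) : R[i] :=
  cos (2 * pi / r%:R) +i* sin (2 * pi / r%:R).

(* The coefficient A_i of w^(-i) is [Q i'] where [i'] is the ordinal i - 1;
   hence the successors below. *)
Definition irregular_type (s : nat) : topologicalType :=
  prod_topology (fun _ : 'I_s => complex_space T).

Variable s : nat.
Implicit Types Q : irregular_type s.

Definition generates_orbit (r : nat) (w : 'End(T)) Q : Prop :=
  weyl Phi w /\ forall i : 'I_s, w (Q i : T) = zeta r ^+ i.+1 *: (Q i : T).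

Definition galois_closed (r : nat) Q : Prop :=
  exists w, generates_orbit r w Q.

Definition pole_order (a : 'Hom(T, R[i]^o)) Q : nat :=
  \max_(i < s | a (Q i : T) != 0) i.+1.

Definition galois_sim (r : nat) Q Q' : Prop :=
  (exists w, generates_orbit r w Q /\ generates_orbit r w Q') /\
  forall a, Phi a -> pole_order a Q = pole_order a Q'.

Definition deformation_space (r : nat) Q : set (irregular_type s) :=
  [set Q' | galois_sim r Q' Q].

End IrregularTypes.
Arguments irregular_type {R} T s.

Definition posnat : Type := {n : nat | (0 < n)%N}.

Section Arrangements.
Variable R : realType.
Local Notation C := R[i]^o.

Definition Marr (rho k : nat) : set 'rV[C]_k :=
  [set l | forall i j, i != j -> l 0 i ^+ rho != l 0 j ^+ rho].

Definition Marr_sharp (rho k : nat) : set 'rV[C]_k :=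
  [set l | Marr rho l /\ forall i, l 0 i != 0].

Definition Marr_sharp2 (k k' : nat) : set ('rV[C]_k * 'rV[C]_k') :=
  [set lm | [/\ Marr_sharp 2 lm.1, Marr 2 lm.2 &
     forall i j, lm.1 0 i ^+ 2 != lm.2 0 j ^+ 2]].

Definition finitely_supported (mu : posnat -> posnat -> nat) : Prop :=
  finite_set [set p : posnat * posnat | mu p.1 p.2 != 0%N].

(* The factors whose multiplicity is 0 are one-point spaces, as ['I_0] is
   empty. *)
Definition power_product (X : nat -> nat -> topologicalType)
    (mu : posnat -> posnat -> nat) : topologicalType :=
  prod_topology (fun p : posnat * posnat =>
    prod_topology (fun _ : 'I_(mu p.1 p.2) => X (val p.1) (val p.2))).

Definition arrangement_product (mu mu_sharp mu_sharp2 : posnat -> posnat -> nat)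
    : topologicalType :=
  (power_product (fun rho k => set_type (@Marr rho k)) mu *
   power_product (fun rho k => set_type (@Marr_sharp rho k)) mu_sharp *
   power_product (fun k k' => set_type (@Marr_sharp2 k k')) mu_sharp2)%type.

End Arrangements.

(* Main.v *)
Require Import Defs.
From mathcomp Require Import all_boot all_order all_algebra.
From mathcomp Require Import perm complex ring.
From mathcomp Require Import all_classical all_reals all_analysis.

Set Implicit Arguments.
Unset Strict Implicit.
Unset Printing Implicit Defensive.

Import Order.TTheory GRing.Theory Num.Theory.
Import numFieldNormedType.Exports.

Local Open Scope classical_set_scope.
Local Open Scope ring_scope.
Local Open Scope complex_scope.

(* In standard coordinates an irregular type is a family of polar parts Q_a,
   and elements of the Weyl group are signed permutations of the indices a.
   Let zeta act on polar parts by multiplying the coefficient of w^(-i) by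
   zeta_r^i, and let Gamma be the group generated by this action and, outside
   type A, by -1. In types A, B and C, a type Q' belongs to B_r(Q) exactly when
   Q'_a - gamma Q'_b and Q_a - gamma Q_b have the same pole order for all a, b
   and all gamma in Gamma; the choice of a generator g of the orbit plays no
   role. These conditions separate into conditions on the coefficients of each
   w^(-i), and there into blocks: the Gamma-orbits of the classes of indices a
   for which the Q_a agree beyond w^(-i). The stabiliser of a class acts on the
   coefficient of w^(-i) through a group of rho-th roots of unity; the distinct
   values of the coefficient on the class form orbits of this group, and
   choosing one value in each orbit identifies the block with M(1, k) if
   rho = 1, and with M^sharp(rho, k) otherwise.
   In type A the coefficients also have sum 0. This is automatic unless zeta
   acts trivially on w^(-i), and then it is traded for the vanishing of one
   value, which turns one M(1, k) into M^sharp(1, k - 1).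
   In type D the pole order of Q_a itself is not prescribed, as 2 e_a is not a
   root. This only matters in the block of the a for which Q_a has pole order
   at most i, and only if zeta acts on w^(-i) by 1 or -1: values taken at a
   single index up to sign may then vanish, while the other ones may not, which
   gives M^sharpsharp(k, k'). *)

(** * Homeomorphisms *)

Section Topology.

Lemma continuous_prod_topology (I : Type) (T : I -> topologicalType)
    (X : topologicalType) (f : X -> prod_topology T) :
  (forall i, continuous (fun x => f x i)) -> continuous f.
Proof.
move=> cf x; apply/cvg_sup => i.
have : continuous (f : X -> initial_topology (fun h : prod_topology T => h i)).
  exact/continuous_comp_initial/cf.
exact.
Qed.

Lemma continuous_set_type (X Y : topologicalType) (A : set Y)
    (f : X -> set_type A) :
  continuous (fun x => \val (f x)) -> continuous f.
Proof. exact: continuous_comp_initial. Qed.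

Lemma continuous_val (X : topologicalType) (A : set X) :
  continuous (fun x : set_type A => \val x).
Proof. exact: initial_continuous. Qed.

Lemma continuous_pair (X Y Z : topologicalType) (f : X -> Y) (g : X -> Z) :
  continuous f -> continuous g -> continuous (fun x => (f x, g x)).
Proof. by move=> cf cg x; apply: cvg_pair; [exact: cf|exact: cg]. Qed.

Lemma continuous_compose (X Y Z : topologicalType) (g : Y -> Z) (f : X -> Y) :
  continuous f -> continuous g -> continuous (fun x => g (f x)).
Proof. by move=> cf cg x; apply: continuous_comp; [exact: cf|exact: cg]. Qed.

Lemma continuous_id (X : topologicalType) : continuous (fun x : X => x).
Proof. by move=> x; exact: cvg_id. Qed.

Lemma continuous_fst (X Y Z : topologicalType) (f : X -> Y * Z) :
  continuous f -> continuous (fun x => (f x).1).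
Proof. by move=> cf; apply: continuous_compose cf _ => x; exact: cvg_fst. Qed.

Lemma continuous_snd (X Y Z : topologicalType) (f : X -> Y * Z) :
  continuous f -> continuous (fun x => (f x).2).
Proof. by move=> cf; apply: continuous_compose cf _ => x; exact: cvg_snd. Qed.

Lemma continuous_proj (I : Type) (T : I -> topologicalType) (i : I) :
  continuous (fun f : prod_topology T => f i).
Proof.
move=> f; have /cvg_sup/(_ i) cf : (f : prod_topology T) --> f by exact: cvg_id.
apply: cvg_trans (@initial_continuous _ _ (fun h : prod_topology T => h i) f).
exact: cvg_app cf.
Qed.

Lemma homeomorphic_trans (X Y Z : topologicalType) :
  homeomorphic X Y -> homeomorphic Y Z -> homeomorphic X Z.
Proof.
move=> [f [f' [cf cf' fK f'K]]] [g [g' [cg cg' gK g'K]]].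
exists (g \o f), (f' \o g'); split.
- exact: continuous_compose.
- exact: continuous_compose.
- exact: can_comp.
- exact: can_comp.
Qed.

Lemma homeomorphic_prod (X X' Y Y' : topologicalType) :
  homeomorphic X Y -> homeomorphic X' Y' ->
      homeomorphic (X * X')%type (Y * Y')%type.
Proof.
move=> [f [f' [cf cf' fK f'K]]] [g [g' [cg cg' gK g'K]]].
exists (fun x => (f x.1, g x.2)), (fun y => (f' y.1, g' y.2)); split.
- by apply: continuous_pair;
    [exact: continuous_compose (continuous_fst (@continuous_id _)) cf|
     exact: continuous_compose (continuous_snd (@continuous_id _)) cg].
- by apply: continuous_pair;
    [exact: continuous_compose (continuous_fst (@continuous_id _)) cf'|
     exact: continuous_compose (continuous_snd (@continuous_id _)) cg'].
- by case=> a b /=; rewrite fK gK.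
- by case=> a b /=; rewrite f'K g'K.
Qed.

(** The two maps live on the ambient spaces and need to be inverse to each other only on [A] and
    [B]. Explicit coordinate formulas can thus be used without restricting them first. *)
Lemma homeomorphic_sets (X Y : topologicalType) (A : set X) (B : set Y)
    (f : X -> Y) (f' : Y -> X) :
  continuous f -> continuous f' ->
  (forall x, A x -> B (f x)) -> (forall y, B y -> A (f' y)) ->
  (forall x, A x -> f' (f x) = x) -> (forall y, B y -> f (f' y) = y) ->
  homeomorphic (set_type A) (set_type B).
Proof.
move=> cf cf' fAB f'BA fK f'K.
have fP (x : set_type A) : f (\val x) \in B.
  by apply/mem_set/fAB/set_mem/valP.
have f'P (y : set_type B) : f' (\val y) \in A.
  by apply/mem_set/f'BA/set_mem/valP.
exists (fun x => exist _ (f (\val x)) (fP x)),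
  (fun y => exist _ (f' (\val y)) (f'P y)); split.
- by apply: continuous_set_type; apply: continuous_compose cf;
    exact: continuous_val.
- by apply: continuous_set_type; apply: continuous_compose cf';
    exact: continuous_val.
- by move=> x; apply: val_inj; apply: fK; apply/set_mem/valP.
- by move=> y; apply: val_inj; apply: f'K; apply/set_mem/valP.
Qed.

Lemma homeomorphic_sets_prod (X Y Z : topologicalType) (A : set X) (B : set Y)
    (C : set Z) (f : X -> Y) (g : X -> Z) (h : Y * Z -> X) :
  continuous f -> continuous g -> continuous h ->
  (forall x, A x -> B (f x)) -> (forall x, A x -> C (g x)) ->
  (forall y z, B y -> C z -> A (h (y, z))) ->
  (forall x, A x -> h (f x, g x) = x) ->
  (forall y z, B y -> C z -> f (h (y, z)) = y /\ g (h (y, z)) = z) ->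
  homeomorphic (set_type A) (set_type B * set_type C)%type.
Proof.
move=> cf cg ch fAB gAC hA hK fgK.
apply: (@homeomorphic_trans _ (set_type (B `*` C))).
  apply: (@homeomorphic_sets _ _ _ _ (fun x => (f x, g x)) h) => //.
  - exact: continuous_pair.
  - by move=> x Ax; split; [exact: fAB|exact: gAC].
  - by case=> y z [/= By Cz]; exact: hA.
  - by case=> y z [/= By Cz]; have [-> ->] := fgK y z By Cz.
exists (@setX_of_sigT _ _ B C), (@sigT_of_setX _ _ B C); split.
- exact: setX_of_sigT_continuous.
- exact: sigT_of_setX_continuous.
- exact: setX_of_sigTK.
- exact: sigT_of_setXK.
Qed.

End Topology.

(** * Products of arrangement complements *)

Section PowerProduct.
Variable X : nat -> nat -> topologicalType.
Implicit Types mu : posnat -> posnat -> nat.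

Definition singleton_space (Y : Type) := exists p : Y, forall q, q = p.

Lemma homeomorphic_singletons (Y Z : topologicalType) :
  singleton_space Y -> singleton_space Z -> homeomorphic Y Z.
Proof.
move=> [y yP] [z zP]; exists (fun=> z), (fun=> y); split.
- by move=> ?; exact: cvg_cst.
- by move=> ?; exact: cvg_cst.
- by move=> u; rewrite (yP u).
- by move=> u; rewrite (zP u).
Qed.

Lemma homeomorphic_singletonl (Y Z : topologicalType) :
  singleton_space Z -> homeomorphic Y (Z * Y)%type.
Proof.
move=> [z zP]; exists (fun y => (z, y)), snd; split => //.
- by apply: continuous_pair => ?; [exact: cvg_cst|exact: cvg_id].
- by move=> ?; exact: cvg_snd.
- by case=> z' y; rewrite (zP z').
Qed.

Lemma homeomorphic_singletonr (Y Z : topologicalType) :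
  singleton_space Z -> homeomorphic Y (Y * Z)%type.
Proof.
move=> [z zP]; exists (fun y => (y, z)), fst; split => //.
- by apply: continuous_pair => ?; [exact: cvg_id|exact: cvg_cst].
- by move=> ?; exact: cvg_fst.
- by case=> y z'; rewrite (zP z').
Qed.

Lemma singleton_power_product0 :
  singleton_space (power_product X (fun _ _ => 0%N)).
Proof.
have f0 (p : posnat * posnat) (i : 'I_0) : X (val p.1) (val p.2) by case: i.
by exists f0 => q; apply: functional_extensionality_dep => p;
  apply: functional_extensionality_dep => -[].
Qed.

(** Each index type ['I_(m + m')] splits into ['I_m] and ['I_m'], so multiplicities add up when
    products are taken. *)
Lemma power_product_add mu mu' :
  homeomorphic (power_product X mu * power_product X mu')%type
    (power_product X (fun p q => mu p q + mu' p q)%N).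
Proof.
pose f (x : power_product X mu * power_product X mu') :
    power_product X (fun p q => mu p q + mu' p q)%N :=
  fun p i => match fintype.split i with inl j => x.1 p j | inr j => x.2 p j end.
pose f' (y : power_product X (fun p q => mu p q + mu' p q)%N) :
    (power_product X mu * power_product X mu')%type :=
  (fun p i => y p (lshift _ i), fun p i => y p (rshift _ i)).
have cX nu p i : continuous (fun x : power_product X nu => x p i).
  exact: continuous_compose (@continuous_proj _ _ p) (@continuous_proj _ _ i).
exists f, f'; split.
- apply: continuous_prod_topology => p; apply: continuous_prod_topology => i.
  rewrite /f; case: (fintype.split i) => j.
    exact: continuous_compose (continuous_fst (@continuous_id _)) (cX _ p j).
  exact: continuous_compose (continuous_snd (@continuous_id _)) (cX _ p j).
- by apply: continuous_pair; apply: continuous_prod_topology => p;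
    apply: continuous_prod_topology => i; exact: cX.
- case=> x y; congr (_, _); apply: functional_extensionality_dep => p;
    apply: functional_extensionality_dep => i; rewrite /f /=.
    by rewrite (unsplitK (inl i)).
  by rewrite (unsplitK (inr i)).
- move=> y; apply: functional_extensionality_dep => p;
    apply: functional_extensionality_dep => i; rewrite /f /f' /=.
  by rewrite -[in RHS](splitK i); case: (fintype.split i).
Qed.

Definition single_mult (p q : posnat) : posnat -> posnat -> nat :=
  fun p' q' => ((p, q) == (p', q')).

Lemma power_product_single p q :
  homeomorphic (X (val p) (val q)) (power_product X (single_mult p q)).
Proof.
(* An index over [u] exists only if [u] is [(p, q)]; the coordinate there is [x] transported along
   this equality. *)
have eqP' (u : posnat * posnat) (i : 'I_(single_mult p q u.1 u.2)) : (p, q) = u.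
  by move: i; rewrite /single_mult -surjective_pairing;
    case: eqVneq => // _ [].
pose XX (u : posnat * posnat) := X (val u.1) (val u.2).
pose f (x : X (val p) (val q)) : power_product X (single_mult p q) :=
  fun u i => eq_rect (p, q) (fun u => XX u) x u (eqP' u i).
have i0 : 'I_(single_mult p q p q) by rewrite /single_mult eqxx; exact: ord0.
pose f' (y : power_product X (single_mult p q)) := y (p, q) i0.
exists f, f'; split.
- apply: continuous_prod_topology => u; apply: continuous_prod_topology => i.
  by rewrite /f; case: _ / (eqP' u i) => x; exact: cvg_id.
- exact: continuous_compose (@continuous_proj _ _ (p, q))
    (@continuous_proj _ _ i0).
- by move=> x; rewrite /f' /f (eq_irrelevance (eqP' _ _) erefl).
- move=> y; apply: functional_extensionality_dep => u;
    apply: functional_extensionality_dep => i; rewrite /f /f' /=.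
  move: (eqP' u i) => e; case: _ / e i => i /=; suff -> : i0 = i by [].
  have ord0_eq (k l : 'I_(single_mult p q p q)) : k = l.
    apply: val_inj; move: (ltn_ord k) (ltn_ord l).
    rewrite {2 4}/single_mult eqxx /= !ltnS !leqn0.
    by move=> /eqP -> /eqP ->.
  exact: ord0_eq.
Qed.

Lemma finitely_supported0 : finitely_supported (fun _ _ => 0%N).
Proof.
rewrite /finitely_supported (_ : [set _ | _] = set0) //.
by rewrite predeqE => p; split.
Qed.

Lemma finitely_supported_single p q : finitely_supported (single_mult p q).
Proof.
apply: (@sub_finite_set _ _ [set (p, q)]); last exact: finite_set1.
move=> u /=; by rewrite /single_mult -surjective_pairing; case: ((p, q) =P u).
Qed.

Lemma finitely_supported_add mu mu' :
  finitely_supported mu -> finitely_supported mu' ->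
  finitely_supported (fun p q => mu p q + mu' p q)%N.
Proof.
move=> fm fm'; apply: sub_finite_set
  (_ : _ `<=` [set p : posnat * posnat | mu p.1 p.2 != 0%N] `|`
     [set p | mu' p.1 p.2 != 0%N]) _; last by rewrite finite_setU.
by move=> p /=; case: (mu p.1 p.2) => [|m]; [right|left].
Qed.

End PowerProduct.

(** * Spaces homeomorphic to a finite product of arrangement complements *)

Section Arranged.
Variables (R : realType) (D : Prop).

(* [D] is the condition under which factors of the third kind may occur. *)
Definition arranged (X : topologicalType) :=
  exists mu mu_sharp mu_sharp2 : posnat -> posnat -> nat,
    [/\ [/\ finitely_supported mu, finitely_supported mu_sharp
          & finitely_supported mu_sharp2],
        homeomorphic X (arrangement_product R mu mu_sharp mu_sharp2)
      & (exists k k', mu_sharp2 k k' <> 0%N) -> D].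

Lemma arranged_homeo (X Y : topologicalType) :
  homeomorphic X Y -> arranged Y -> arranged X.
Proof.
move=> XY [m [m1 [m2 [fin h d]]]]; exists m, m1, m2; split=> //.
exact: homeomorphic_trans XY h.
Qed.

Lemma arranged_singleton (X : topologicalType) :
  singleton_space X -> arranged X.
Proof.
move=> X1; exists (fun _ _ => 0%N), (fun _ _ => 0%N), (fun _ _ => 0%N); split.
- by split; exact: finitely_supported0.
- apply: homeomorphic_singletons => //.
  have [a aP] :=
    singleton_power_product0 (fun rho k => set_type (@Marr R rho k)).
  have [b bP] :=
    singleton_power_product0 (fun rho k => set_type (@Marr_sharp R rho k)).
  have [c cP] :=
    singleton_power_product0 (fun rho k => set_type (@Marr_sharp2 R rho k)).
  by exists (a, b, c) => -[[x y] z]; rewrite (aP x) (bP y) (cP z).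
- by case=> ? [].
Qed.

Lemma arranged_Marr (p q : posnat) :
  arranged (set_type (@Marr R (val p) (val q))).
Proof.
exists (single_mult p q), (fun _ _ => 0%N), (fun _ _ => 0%N); split.
- by split;
    [exact: finitely_supported_single|exact: finitely_supported0..].
- apply: (homeomorphic_trans _
    (homeomorphic_singletonr _ (singleton_power_product0 _))).
  apply: (homeomorphic_trans _
    (homeomorphic_singletonr _ (singleton_power_product0 _))).
  exact: (power_product_single (fun rho k => set_type (@Marr R rho k))).
- by case=> ? [].
Qed.

Lemma arranged_Marr_sharp (p q : posnat) :
  arranged (set_type (@Marr_sharp R (val p) (val q))).
Proof.
exists (fun _ _ => 0%N), (single_mult p q), (fun _ _ => 0%N); split.
- by split;
    [exact: finitely_supported0|exact: finitely_supported_single|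
     exact: finitely_supported0].
- apply: (homeomorphic_trans _
    (homeomorphic_singletonr _ (singleton_power_product0 _))).
  apply: (homeomorphic_trans _
    (homeomorphic_singletonl _ (singleton_power_product0 _))).
  exact: (power_product_single (fun rho k => set_type (@Marr_sharp R rho k))).
- by case=> ? [].
Qed.

Lemma arranged_Marr_sharp2 (p q : posnat) :
  D -> arranged (set_type (@Marr_sharp2 R (val p) (val q))).
Proof.
move=> d; exists (fun _ _ => 0%N), (fun _ _ => 0%N), (single_mult p q); split.
- by split;
    [exact: finitely_supported0..|exact: finitely_supported_single].
- apply: (homeomorphic_trans _ (homeomorphic_singletonl _ _)).
    exact: (power_product_single (fun rho k =>
      set_type (@Marr_sharp2 R rho k))).
  have [a aP] :=
    singleton_power_product0 (fun rho k => set_type (@Marr R rho k)).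
  have [b bP] :=
    singleton_power_product0 (fun rho k => set_type (@Marr_sharp R rho k)).
  by exists (a, b) => -[x y]; rewrite (aP x) (bP y).
- by [].
Qed.

Lemma homeomorphic_prodACA (A B C A' B' C' : topologicalType) :
  homeomorphic ((A * B * C) * (A' * B' * C'))%type
    ((A * A') * (B * B') * (C * C'))%type.
Proof.
pose f (x : (A * B * C) * (A' * B' * C')) :=
  ((x.1.1.1, x.2.1.1), (x.1.1.2, x.2.1.2), (x.1.2, x.2.2)).
pose f' (y : (A * A') * (B * B') * (C * C')) :=
  ((y.1.1.1, y.1.2.1, y.2.1), (y.1.1.2, y.1.2.2, y.2.2)).
exists f, f'; split.
- do ?apply: continuous_pair;
    do ?[exact: continuous_id|apply: continuous_fst|apply: continuous_snd].
- do ?apply: continuous_pair;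
    do ?[exact: continuous_id|apply: continuous_fst|apply: continuous_snd].
- by case=> [[[? ?] ?] [[? ?] ?]].
- by case=> [[[? ?] [? ?]] [? ?]].
Qed.

Lemma arranged_prod (X Y : topologicalType) :
  arranged X -> arranged Y -> arranged (X * Y)%type.
Proof.
move=> [m [m1 [m2 [[f f1 f2] h d]]]] [n [n1 [n2 [[g g1 g2] k e]]]].
exists (fun p q => m p q + n p q)%N, (fun p q => m1 p q + n1 p q)%N,
  (fun p q => m2 p q + n2 p q)%N; split.
- by split; exact: finitely_supported_add.
- apply: homeomorphic_trans (homeomorphic_prod h k) _.
  apply: homeomorphic_trans (homeomorphic_prodACA _ _ _ _ _ _) _.
  apply: homeomorphic_prod; last exact: power_product_add.
  by apply: homeomorphic_prod; exact: power_product_add.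
- move=> [p [q]]; have [m0|] := eqVneq (m2 p q) 0%N.
    by rewrite m0 => n0; apply: e; exists p, q.
  by move=> /eqP m0 _; apply: d; exists p, q.
Qed.

End Arranged.

(** * Coordinate spaces *)

Section CoordinateSpace.
Variable R : realType.
Local Notation C := R[i]^o.

Definition cspace (J : Type) : topologicalType :=
  prod_topology (fun _ : J => C).

Section Continuity.
Variables (J : Type) (X : topologicalType).

Lemma continuous_coord (a : J) : continuous (fun x : cspace J => x a : C).
Proof. exact: continuous_proj. Qed.

Lemma continuous_scale (c : C) (f : X -> C) :
  continuous f -> continuous (fun x => c * f x).
Proof.
move=> cf; apply: continuous_compose cf _ => x; exact: mulrl_continuous.
Qed.

Lemma continuous_add (f g : X -> C) :
  continuous f -> continuous g -> continuous (fun x => f x + g x).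
Proof. by move=> cf cg x; apply: continuousD; [exact: cf|exact: cg]. Qed.

Lemma continuous_sum (I : Type) (r : seq I) (P : pred I) (f : I -> X -> C) :
  (forall i, continuous (f i)) ->
      continuous (fun x => \sum_(i <- r | P i) f i x).
Proof.
move=> cf; elim: r => [|i r IHr].
  by rewrite (_ : (fun x => _) = fun=> 0);
    [move=> x; exact: cvg_cst|apply/funext => x; rewrite big_nil].
rewrite (_ : (fun x => _) = fun x => (if P i then f i x else 0) +
    \sum_(j <- r | P j) f j x); last first.
  by apply/funext => x; rewrite big_cons; case: (P i); rewrite ?add0r.
apply: continuous_add IHr; case: (P i); first exact: cf.
exact: cst_continuous.
Qed.

(** A neighbourhood of a row contains a product of neighbourhoods of its finitely many entries. *)
Lemma continuous_row k (f : X -> 'rV[C]_k) :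
  (forall j, continuous (fun x => f x 0 j)) -> continuous f.
Proof.
move=> cf x A [P Pfx sPA].
rewrite nbhs_simpl /=.
have : \forall y \near x, forall j, P 0 j (f y 0 j).
  by apply: filter_forall => j; exact: cf (Pfx 0 j).
apply: filterS => y Py; apply: sPA => i j; rewrite ord1; exact: Py.
Qed.

End Continuity.

(** Many of the coordinate changes below are of this shape: each new coordinate is a constant times
    an old one. *)
Lemma continuous_monomial (J J' : Type) (c : J' -> C) (s : J' -> J) :
  continuous (fun x : cspace J => (fun a => c a * x (s a)) : cspace J').
Proof.
apply: continuous_prod_topology => a.
exact/continuous_scale/continuous_coord.
Qed.

(** * Splitting a coordinate space along a partition of the indices *)

Section Blocks.
Variable J : finType.
Implicit Types (x y : cspace J) (S : set (cspace J)) (B : pred J).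

(** Stands for C^B, realised inside C^J so that the index type stays the same for all blocks. *)
Definition supported B : set (cspace J) :=
  [set x | forall a, ~~ B a -> x a = 0].

Definition local_on B S :=
  forall x y, (forall a, B a -> x a = y a) -> S x -> S y.

Definition restriction B (x : cspace J) : cspace J := fun a => (B a)%:R * x a.

Lemma restrictionT B x a : B a -> restriction B x a = x a.
Proof. by rewrite /restriction => ->; rewrite mul1r. Qed.

Lemma restrictionF B x a : ~~ B a -> restriction B x a = 0.
Proof. by rewrite /restriction => /negPf ->; rewrite mul0r. Qed.

Lemma continuous_restriction B : continuous (restriction B).
Proof. exact: continuous_monomial. Qed.

(** A vector is the sum of its restrictions to the blocks, and each condition [P k] sees a single
    block. The set is therefore the product of its blocks, which are split off one by one. *)
Lemma arranged_blocks D (K : finType) (bl : J -> K) (P : K -> set (cspace J)) :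
  (forall k, local_on (fun a => bl a == k) (P k)) ->
  (forall k,
     arranged R D (set_type (supported (fun a => bl a == k) `&` P k))) ->
  arranged R D (set_type [set x | forall k, P k x]).
Proof.
move=> Ploc Parr.
(* The induction runs over lists of blocks, the coordinates outside the listed blocks being 0. *)
suff H (s : seq K) : uniq s -> arranged R D (set_type
    (supported (fun a => bl a \in s) `&` [set x | forall k, k \in s -> P k x])).
  have := H (enum K) (enum_uniq _); congr (arranged R D (set_type _)).
  apply/predeqP => x; split=> [[_ Px] k|Px]; first by apply: Px;
    rewrite mem_enum.
  by split=> // a; rewrite mem_enum.
elim: s => [_|k s IHs /= /andP[ks us]].
  apply: arranged_singleton.
  have x0P : (fun=> 0 : C) \in (supported (fun a => bl a \in [::]) `&`
      [set x | forall k, k \in [::] -> P k x]).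
    by apply/mem_set; split.
  exists (exist _ (fun=> 0 : C) x0P) => -[x xP]; apply: val_inj => /=.
  apply/funext => a; have [xs _] := set_mem xP.
  exact: xs.
apply: arranged_homeo (arranged_prod (Parr k) (IHs us)).
apply: (@homeomorphic_sets_prod _ _ _ _ _ _ (restriction (fun a => bl a == k))
  (restriction (fun a => bl a != k))
  (fun yz => (fun a => yz.1 a + yz.2 a) : cspace J)).
- exact: continuous_restriction.
- exact: continuous_restriction.
- apply: continuous_prod_topology => a; apply: continuous_add.
    exact: continuous_compose (continuous_fst (@continuous_id _))
      (@continuous_coord _ a).
  exact: continuous_compose (continuous_snd (@continuous_id _))
    (@continuous_coord _ a).
- move=> x [xs xP]; split; first by move=> a; exact: restrictionF.
  have := xP k (mem_head _ _); apply: Ploc => a ak.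
  by rewrite restrictionT.
- move=> x [xs xP]; split.
    move=> a as_; have [ak|ak] := eqVneq (bl a) k.
      by rewrite restrictionF // ak negbK.
    rewrite restrictionT //; apply: xs; rewrite inE negb_or ak; exact: as_.
  move=> l ls; have : P l x by apply: xP; rewrite inE ls orbT.
  apply: Ploc => a /eqP al; rewrite restrictionT // al.
  by apply: contraNneq ks => <-.
- move=> y z [ys yP] [zs zP]; split.
    move=> a; rewrite inE negb_or => /andP[ak as_] /=.
    by rewrite ys // zs // addr0.
  move=> l; rewrite inE => /predU1P[->|ls].
    apply: Ploc yP => a /eqP ak /=.
    by rewrite zs ?addr0 // ak.
  apply: Ploc (zP l ls) => a /eqP al /=.
  by rewrite ys ?add0r // al; apply: contraNneq ks => <-.
- move=> x [xs xP]; apply/funext => a /=; rewrite /restriction.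
  by case: (bl a == k); rewrite /= ?mul1r ?mul0r ?addr0 ?add0r.
- move=> y z [ys yP] [zs zP]; split; apply/funext => a /=;
    rewrite /restriction; case: (eqVneq (bl a) k) => ak /=.
  + by rewrite mul1r zs ?addr0 // ak.
  + by rewrite mul0r ys.
  + by rewrite mul0r zs // ak.
  + by rewrite mul1r ys ?add0r.
Qed.

End Blocks.
End CoordinateSpace.

(** * Configurations as arrangement complements *)

Section Configurations.
Variables (R : realType) (J : finType).
Local Notation C := R[i]^o.
Implicit Types (x y : cspace R J) (A B N : {set J}).

(** A common form of the three arrangement complements: [N] empty gives M(rho, k), [N = A] gives
    M^sharp(rho, k), and rho = 2 with [N] inside [A] gives M^sharpsharp, whose sizes are those of
    [N] and of its complement in [A]. *)
Definition configuration (rho : nat) A N : set (cspace R J) :=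
  [set x | [/\ forall a, a \notin A -> x a = 0,
     forall a b, a \in A -> b \in A -> a != b -> x a ^+ rho != x b ^+ rho
   & forall a, a \in N -> x a != 0]].

Lemma singleton_configuration0 rho N : N \subset finset.set0 ->
  singleton_space (set_type (configuration rho finset.set0 N)).
Proof.
move=> N0.
have x0P : (fun=> 0 : C) \in configuration rho finset.set0 N.
  apply/mem_set; split=> // a; first by rewrite !inE.
  by move=> /(fintype.subsetP N0); rewrite inE.
exists (exist _ (fun=> 0 : C) x0P) => -[x xP]; apply: val_inj => /=.
by apply/funext => a; have [x0 _ _] := set_mem xP; apply: x0; rewrite inE.
Qed.

Section Coordinates.
Variables (B : {set J}) (b0 : J) (b0B : b0 \in B).

Definition to_row (x : cspace R J) : 'rV[C]_#|B| :=
  \row_j x (@enum_val J (mem B) j).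

(** The point [b0] of [B] is what [enum_rank_in] requires in order to invert the enumeration of
    [B]. *)
Definition of_row (l : 'rV[C]_#|B|) : cspace R J :=
  fun a => if a \in B then l 0 (enum_rank_in b0B a) else 0.

Lemma continuous_to_row : continuous to_row.
Proof.
apply: continuous_row => j.
have -> : (fun x : cspace R J => to_row x 0 j) =
    fun x => x (@enum_val J (mem B) j) by apply/funext => x; rewrite mxE.
exact: continuous_coord.
Qed.

Lemma continuous_of_row : continuous of_row.
Proof.
apply: continuous_prod_topology => a; rewrite /of_row; case: (a \in B).
  exact: (@coord_continuous C 1 #|B| 0 (enum_rank_in b0B a)).
exact: cst_continuous.
Qed.

Lemma to_rowE x j : to_row x 0 j = x (@enum_val J (mem B) j).
Proof. by rewrite mxE. Qed.

Lemma to_row_rank x a : a \in B -> to_row x 0 (enum_rank_in b0B a) = x a.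
Proof. by move=> aB; rewrite mxE enum_rankK_in. Qed.

Lemma of_row_val l j : of_row l (@enum_val J (mem B) j) = l 0 j.
Proof. by rewrite /of_row enum_valP enum_valK_in. Qed.

Lemma of_row_in l a : a \in B -> of_row l a = l 0 (enum_rank_in b0B a).
Proof. by rewrite /of_row => ->. Qed.

Lemma of_row_out l a : a \notin B -> of_row l a = 0.
Proof. by rewrite /of_row => /negPf ->. Qed.

Lemma to_rowK x : (forall a, a \notin B -> x a = 0) -> of_row (to_row x) = x.
Proof.
move=> x0; apply/funext => a; rewrite /of_row; case: ifPn => aB.
  exact: to_row_rank.
by rewrite x0.
Qed.

Lemma of_rowK l : to_row (of_row l) = l.
Proof. by apply/rowP => j; rewrite to_rowE of_row_val. Qed.

Lemma enum_rank_in_neq a b : a \in B -> b \in B -> a != b ->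
  enum_rank_in b0B a != enum_rank_in b0B b.
Proof.
move=> aB bB; apply: contra_neq => /(congr1 (@enum_val J (mem B))).
by rewrite !enum_rankK_in.
Qed.

Lemma enum_val_neq (i j : 'I_#|B|) :
  i != j -> @enum_val J (mem B) i != @enum_val J (mem B) j.
Proof. by rewrite (inj_eq enum_val_inj). Qed.

Lemma Marr_to_row rho x :
  (forall a b, a \in B -> b \in B -> a != b -> x a ^+ rho != x b ^+ rho) ->
  Marr rho (to_row x).
Proof.
by move=> xB i j ij; rewrite !to_rowE; apply: xB (enum_val_neq ij);
  exact: enum_valP.
Qed.

Lemma of_row_Marr rho l : Marr rho l -> forall a b, a \in B -> b \in B ->
  a != b -> of_row l a ^+ rho != of_row l b ^+ rho.
Proof.
by move=> lM a b aB bB ab; rewrite !of_row_in //; apply: lM;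
  exact: enum_rank_in_neq.
Qed.

Lemma configuration_Marr rho :
  homeomorphic (set_type (configuration rho B finset.set0))
    (set_type (@Marr R rho #|B|)).
Proof.
apply: (homeomorphic_sets continuous_to_row continuous_of_row).
- by move=> x [_ xB _]; exact: Marr_to_row.
- move=> l lM; split; [exact: of_row_out|exact: of_row_Marr|].
  by move=> a; rewrite inE.
- by move=> x [x0 _ _]; exact: to_rowK.
- by move=> l _; exact: of_rowK.
Qed.

Lemma configuration_Marr_sharp rho :
  homeomorphic (set_type (configuration rho B B))
    (set_type (@Marr_sharp R rho #|B|)).
Proof.
apply: (homeomorphic_sets continuous_to_row continuous_of_row).
- move=> x [_ xB xN]; split; first exact: Marr_to_row.
  by move=> i; rewrite to_rowE; apply: xN; exact: enum_valP.
- move=> l [lM lN]; split; [exact: of_row_out|exact: of_row_Marr|].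
  by move=> a aB; rewrite of_row_in.
- by move=> x [x0 _ _]; exact: to_rowK.
- by move=> l _; exact: of_rowK.
Qed.

End Coordinates.

(** The coordinates in [N], which may not vanish, form the first row, and the other coordinates of
    [A] form the second. Since these index sets are disjoint, the inverse map is the sum of the two
    extensions by 0. *)
Lemma configuration_Marr_sharp2 A N a0 b0 :
  a0 \in N -> b0 \in A :\: N -> N \subset A ->
  homeomorphic (set_type (configuration 2 A N))
    (set_type (@Marr_sharp2 R #|N| #|A :\: N|)).
Proof.
move=> a0N b0N NA.
apply: (@homeomorphic_sets _ _ _ _ (fun x => (to_row N x, to_row (A :\: N) x))
  (fun l => (fun a => of_row a0N l.1 a + of_row b0N l.2 a) : cspace R J)).
- by apply: continuous_pair; exact: continuous_to_row.
- have cf := continuous_fst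
    (@continuous_id ('rV[C]_#|N| * 'rV[C]_#|A :\: N|)%type).
  have cs := continuous_snd
    (@continuous_id ('rV[C]_#|N| * 'rV[C]_#|A :\: N|)%type).
  apply: continuous_prod_topology => a; apply: continuous_add.
    exact: (continuous_compose
      (continuous_compose cf (@continuous_of_row _ _ a0N))
      (@continuous_coord R J a)).
  exact: (continuous_compose
    (continuous_compose cs (@continuous_of_row _ _ b0N))
    (@continuous_coord R J a)).
- move=> x [x0 xA xN]; split=> /=.
  + split.
      by apply: Marr_to_row => a b aN bN; apply: xA;
        exact: (fintype.subsetP NA).
    by move=> i; rewrite to_rowE; apply: xN; exact: enum_valP.
  + by apply: Marr_to_row => a b /finset.setDP[aA _] /finset.setDP[bA _];
      exact: xA.
  + move=> i j; rewrite !to_rowE.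
    have iN := enum_valP i; have /finset.setDP[jA jN] := enum_valP j.
    apply: xA => //; first exact: (fintype.subsetP NA).
    by apply: contraNneq jN => <-.
- case=> l m [/= [lM lN] mM lm].
  have eN a : a \in N -> of_row a0N l a + of_row b0N m a = of_row a0N l a.
    by move=> aN; rewrite (of_row_out b0N) ?addr0 // inE aN.
  have eA a : a \in A :\: N -> of_row a0N l a + of_row b0N m a = of_row b0N m a.
    by move=> /finset.setDP[_ aN]; rewrite (of_row_out a0N) ?add0r.
  have lm' a b : a \in N -> b \in A :\: N ->
      of_row a0N l a ^+ 2 != of_row b0N m b ^+ 2.
    by move=> aN bN; rewrite !of_row_in.
  split.
  + move=> a aA; rewrite !of_row_out ?addr0 //.
      by apply: contra aA => /finset.setDP[].
    by apply: contra aA; exact: (fintype.subsetP NA).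
  + move=> a b aA bA ab.
    have [aN|aN] := boolP (a \in N); have [bN|bN] := boolP (b \in N).
    * by rewrite !eN //; exact: of_row_Marr.
    * have bD : b \in A :\: N by rewrite inE bN.
      by rewrite eN // eA //; exact: lm'.
    * have aD : a \in A :\: N by rewrite inE aN.
      by rewrite eA // eN // eq_sym; exact: lm'.
    * have bD : b \in A :\: N by rewrite inE bN.
      have aD : a \in A :\: N by rewrite inE aN.
      by rewrite !eA //; exact: of_row_Marr.
  + by move=> a aN; rewrite eN // of_row_in.
- move=> x [x0 xA xN]; apply/funext => a /=.
  have [aN|aN] := boolP (a \in N).
    rewrite (of_row_in a0N _ aN) (to_row_rank a0N _ aN) of_row_out ?addr0 //.
    by rewrite inE aN.
  rewrite (of_row_out a0N) // add0r.
  have [aA|aA] := boolP (a \in A).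
    have aD : a \in A :\: N by rewrite inE aN.
    by rewrite (of_row_in b0N _ aD) (to_row_rank b0N _ aD).
  by rewrite of_row_out ?x0 //; apply: contra aA => /finset.setDP[].
- case=> l m _ /=; congr (_, _); apply/rowP => j; rewrite to_rowE /=.
    rewrite of_row_val of_row_out ?addr0 // inE.
    by have := enum_valP j => /= ->.
  rewrite of_row_val of_row_out ?add0r //.
  by have /finset.setDP[] := enum_valP j.
Qed.

(** Factors are indexed by k >= 1, so the empty configuration is treated apart, as a one-point
    space. *)
Lemma arranged_configuration0 D rho A :
  (0 < rho)%N -> arranged R D (set_type (configuration rho A finset.set0)).
Proof.
move=> rho_gt0; have [->|[a aA]] := finset.set_0Vmem A.
  exact/arranged_singleton/singleton_configuration0/subxx.
have A_gt0 : (0 < #|A|)%N by apply/card_gt0P; exists a.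
apply: arranged_homeo (configuration_Marr aA rho) _.
exact: (arranged_Marr R D (exist _ rho rho_gt0) (exist _ #|A| A_gt0)).
Qed.

Lemma arranged_configurationT D rho A :
  (0 < rho)%N -> arranged R D (set_type (configuration rho A A)).
Proof.
move=> rho_gt0; have [->|[a aA]] := finset.set_0Vmem A.
  exact/arranged_singleton/singleton_configuration0.
have A_gt0 : (0 < #|A|)%N by apply/card_gt0P; exists a.
apply: arranged_homeo (configuration_Marr_sharp aA rho) _.
exact: (arranged_Marr_sharp R D (exist _ rho rho_gt0) (exist _ #|A| A_gt0)).
Qed.

(** M^sharpsharp(k, k') requires k, k' >= 1; if [N] or its complement in [A] is empty, the space is
    M(2, k) or M^sharp(2, k) instead, or a point. *)
Lemma arranged_configuration2 (D : Prop) A N :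
  D -> N \subset A -> arranged R D (set_type (configuration 2 A N)).
Proof.
move=> d NA; have [->|[a aN]] := finset.set_0Vmem N.
  exact: arranged_configuration0.
have [A0|[b bN]] := finset.set_0Vmem (A :\: N).
  have -> : N = A.
    by apply/eqP; rewrite finset.eqEsubset NA /= -finset.setD_eq0 A0.
  exact: arranged_configurationT.
have N_gt0 : (0 < #|N|)%N by apply/card_gt0P; exists a.
have A_gt0 : (0 < #|A :\: N|)%N by apply/card_gt0P; exists b.
apply: arranged_homeo (configuration_Marr_sharp2 aN bN NA) _.
exact: (@arranged_Marr_sharp2 R D (exist _ #|N| N_gt0)
  (exist _ #|A :\: N| A_gt0) d).
Qed.

End Configurations.

(** * Orbits of roots of unity *)

Section RootsOfUnity.
Variable R : realType.
Local Notation C := R[i]^o.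

(** Supplies generic values: 1 plus the sum of all norms exceeds every norm in the list. *)
Lemma exists_notin_seq (s : seq C) : exists c : C, c \notin s.
Proof.
pose c : C := 1 + \sum_(x <- s) `|x|.
exists c; apply/negP => cs.
have sum_ge0 (t : seq C) : 0 <= \sum_(x <- t) `|x| by apply: sumr_ge0.
have c_ge0 : 0 <= c by rewrite addr_ge0.
have : `|c| <= \sum_(x <- s) `|x| by rewrite (big_rem c) //= lerDl.
by rewrite (ger0_norm c_ge0) gerDr ler10.
Qed.

(* Lagrange's theorem puts [H] inside the roots of X^#|H| - 1, of which there
   are at most #|H|. *)
Lemma unity_subgroup (H : C -> Prop) m : (0 < m)%N -> H 1 ->
  (forall u v, H u -> H v -> H (u * v)) -> (forall u, H u -> u ^+ m = 1) ->
  exists2 rho, (0 < rho)%N & (forall d, H d <-> d ^+ rho = 1) /\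
    (rho = 1%N \/ exists2 d : C, d ^+ rho = 1 & d != 1).
Proof.
move=> m_gt0 H1 HM Hm.
have [rs rsE] := closed_field_poly_normal ('X^m - 1 : {poly C}).
pose s := undup [seq x <- rs | `[< H x >]].
have sP x : x \in s <-> H x.
  rewrite mem_undup mem_filter; split=> [/andP[/asboolP]//|Hx].
  apply/andP; split; first exact/asboolP.
  have : root ('X^m - 1 : {poly C}) x.
    by rewrite rootE !hornerE (Hm x Hx) subrr.
  rewrite rsE (monicP _) ?scale1r ?root_prod_XsubC //.
  exact: monicXnsubC.
have us : uniq s by exact: undup_uniq.
have s_neq0 x : x \in s -> x != 0.
  move=> /sP /Hm xm; apply/eqP => x0; move: xm; rewrite x0 expr0n.
  by case: m m_gt0 {Hm rsE} => // k _ /eqP; rewrite eq_sym oner_eq0.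
have rho_gt0 : (0 < size s)%N.
  by rewrite lt0n size_eq0; apply/eqP => s0; have /sP := H1; rewrite s0.
have Hrho d : H d -> d ^+ size s = 1.
  move=> Hd; have d0 : d != 0 by exact/s_neq0/sP.
  (* Multiplication by [d] permutes [H], so the non-zero product of all elements of [H] is unchanged
     when multiplied by d^#|H|. *)
  have ps : perm_eq [seq d * x | x <- s] s.
    have ud : uniq [seq d * x | x <- s] by rewrite map_inj_uniq //;
      exact: mulfI.
    apply: uniq_perm => //.
    have [||//] := uniq_min_size ud (s2 := s); last by rewrite size_map.
    by move=> _ /mapP[x xs ->]; apply/sP; apply: HM => //; exact/sP.
  have : \prod_(x <- [seq d * x | x <- s]) x = \prod_(x <- s) x.
    exact: perm_big.
  rewrite big_map big_split /= big_const_seq count_predT iter_mulr_1 => prodE.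
  have prod0 : \prod_(x <- s) x != 0.
    by rewrite prodf_seq_neq0; apply/allP => x /s_neq0.
  apply: (mulIf prod0); rewrite mul1r -[RHS]prodE.
  by [].
exists (size s) => //; split.
  move=> d; split=> [|drho]; first exact: Hrho.
  apply/sP; apply: contraT => ds.
  have P0 : 'X^(size s) - 1 != 0 :> {poly C}.
    by rewrite -size_poly_eq0 size_XnsubC.
  have := @max_poly_roots _ _ (d :: s) P0.
  rewrite /= ds us size_XnsubC // ltnn; apply => //.
  apply/andP; split; first by rewrite rootE !hornerE drho subrr.
  by apply/allP => x /sP /Hrho xr; rewrite rootE !hornerE xr subrr.
have [/allP s1|/allPn[d ds d1]] := boolP (all (pred1 1) s).
  left; apply/eqP; rewrite eqn_leq rho_gt0 andbT.
  apply: (uniq_leq_size us (s2 := [:: 1])) => x /s1 /= /eqP ->.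
  exact: mem_head.
by right; exists d => //; apply/Hrho/sP.
Qed.

Lemma eq_expr_unity rho (x y : C) : (0 < rho)%N -> x ^+ rho = y ^+ rho ->
  exists2 d : C, d ^+ rho = 1 & x = d * y.
Proof.
move=> rho_gt0 xy; have [y0|y0] := eqVneq y 0.
  exists 1; rewrite ?expr1n // mul1r y0; apply/eqP.
  have : x ^+ rho == 0 by rewrite xy y0 expr0n gtn_eqF.
  by rewrite expf_eq0 rho_gt0.
exists (x / y); last by rewrite divfK.
by rewrite expr_div_n xy divff // expf_neq0.
Qed.

End RootsOfUnity.

(** * Vectors with prescribed relations under roots of unity *)

Section Orbits.
Variables (R : realType) (J : finType).
Local Notation C := R[i]^o.
Implicit Types (x y : cspace R J) (p g : J -> C).

Section OrbitSpace.
Variables (B : {set J}) (p g : J -> C) (rho : nat) (N : {set J}).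
Hypotheses (g_neq0 : forall a, g a != 0) (rho_gt0 : (0 < rho)%N).
Hypothesis NB : forall a b, a \in B -> b \in B -> a \in N ->
  p a ^+ rho = p b ^+ rho -> b \in N.

(** The vector [p] is a model. Indices with the same [p a ^+ rho] form a class, on which [g a * x a]
    has the same ratios as [p a]; different classes have different rho-th powers, and [N], a union
    of classes in [B], marks where zeros are forbidden. *)
Definition orbit_space : set (cspace R J) :=
  [set x | [/\ forall a, a \notin B -> x a = 0,
    forall a, a \in B -> p a = 0 -> x a = 0,
    forall a b, a \in B -> b \in B -> p b != 0 -> p a ^+ rho = p b ^+ rho ->
      g a * x a = p a / p b * (g b * x b),
    forall a b, a \in B -> b \in B -> p a != 0 -> p b != 0 ->
      p a ^+ rho != p b ^+ rho -> (g a * x a) ^+ rho != (g b * x b) ^+ rho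
  & forall a, a \in B -> a \in N -> p a != 0 -> x a != 0]].

(** For [a] in [B] the search succeeds, as [a] itself qualifies, so the default value is not
    reached. *)
Definition orbit_rep a := odflt a [pick b in B | p b ^+ rho == p a ^+ rho].

Definition orbit_reps := [set a in B | (p a != 0) && (orbit_rep a == a)].

Lemma orbit_repP a : a \in B ->
  orbit_rep a \in B /\ p (orbit_rep a) ^+ rho = p a ^+ rho.
Proof.
move=> aB; rewrite /orbit_rep; case: pickP => [b /andP[bB /eqP]//|/(_ a)].
by rewrite aB eqxx.
Qed.

Lemma eq_orbit_rep a b : a \in B -> p a ^+ rho = p b ^+ rho ->
  orbit_rep a = orbit_rep b.
Proof.
move=> aB ab; rewrite /orbit_rep ab; case: pickP => //= /(_ a).
by rewrite aB ab eqxx.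
Qed.

Lemma orbit_rep_in a : a \in B -> p a != 0 -> orbit_rep a \in orbit_reps.
Proof.
move=> aB pa; have [rB rE] := orbit_repP aB;
  rewrite inE rB (eq_orbit_rep rB rE) eqxx andbT /=.
have : p (orbit_rep a) ^+ rho != 0 by rewrite rE expf_neq0.
by rewrite expf_eq0 rho_gt0.
Qed.

(** A point of the orbit space is determined by its normalised values [g a * x a] at the class
    representatives, and these values form an arbitrary configuration. *)
Lemma homeomorphic_orbit_space : homeomorphic (set_type orbit_space)
  (set_type (@configuration R J rho orbit_reps (orbit_reps :&: N))).
Proof.
have p0 a b : p a != 0 -> p b ^+ rho = p a ^+ rho -> p b != 0.
  by move=> pa /eqP; apply: contraTneq => ->;
    rewrite expr0n gtn_eqF // eq_sym expf_neq0.
(* This factor recovers [x a] from the normalised value at the representative of [a], by the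
   prescribed ratio. *)
pose c a : C := if (a \in B) && (p a != 0)
  then (g a)^-1 * (p a / p (orbit_rep a)) else 0.
apply: (homeomorphic_sets
  (@continuous_monomial R J J (fun a => (a \in orbit_reps)%:R * g a) id)
  (@continuous_monomial R J J c orbit_rep)).
- move=> x [x0 xp0 xE xD xN].
  have fE a : a \in orbit_reps -> (a \in orbit_reps)%:R * g a * x a = g a * x a.
    by move=> ->; rewrite mul1r.
  split.
  + by move=> a /negPf ->; rewrite !mul0r.
  + move=> a b aA bA ab; rewrite !fE //.
    move: aA bA; rewrite !inE => /and3P[aB pa /eqP ra] /and3P[bB pb /eqP rb].
    apply: xD => //; apply: contra_neq ab => /(eq_orbit_rep aB).
    by rewrite ra rb.
  + move=> a /setIP[aA aN]; rewrite fE // mulf_neq0 //.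
    by move: aA; rewrite inE => /and3P[aB pa _]; exact: xN.
- move=> l [l0 lD lN].
  have fE a : a \in B -> p a != 0 ->
      g a * (c a * l (orbit_rep a)) = p a / p (orbit_rep a) * l (orbit_rep a).
    by move=> aB pa; rewrite /c aB pa !mulrA divff // mul1r.
  split.
  + by move=> a /negPf aB; rewrite /c aB mul0r.
  + by move=> a aB pa; rewrite /c pa eqxx andbF mul0r.
  + move=> a b aB bB pb ab; have pa := p0 _ _ pb ab.
    have rb0 := p0 _ _ pb (orbit_repP bB).2.
    rewrite !fE // (eq_orbit_rep aB ab) mulrA; congr (_ * _).
    by rewrite mulrA divfK.
  + move=> a b aB bB pa pb ab; rewrite !fE // !exprMn !exprVn.
    have [raB ra] := orbit_repP aB; have [rbB rb] := orbit_repP bB.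
    rewrite ra rb !divff ?expf_neq0 // !mul1r; apply: lD.
    * exact: orbit_rep_in.
    * exact: orbit_rep_in.
    * by apply: contra_neq ab => rab; rewrite -ra -rb rab.
  + move=> a aB aN pa; have [raB ra] := orbit_repP aB.
    have ra0 := p0 _ _ pa ra.
    rewrite /c aB pa !mulf_neq0 ?invr_eq0 //; apply: lN.
    by rewrite inE orbit_rep_in //=; apply: NB aN (esym ra).
- move=> x [x0 xp0 xE xD xN]; apply/funext => a; rewrite /c.
  have [aB|aB] := boolP (a \in B); last by rewrite mul0r x0.
  have [pa|pa] := eqVneq (p a) 0; first by rewrite mul0r xp0.
  have [raB ra] := orbit_repP aB.
  rewrite orbit_rep_in // mul1r -mulrA -xE ?mulKf //.
  exact: p0 ra.
- move=> l [l0 lD lN]; apply/funext => a.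
  have [aA|aA] := boolP (a \in orbit_reps); last by rewrite !mul0r l0.
  move: (aA); rewrite inE /c => /and3P[-> pa /eqP ->].
  by rewrite pa divff // mulr1 mul1r mulrA divff // mul1r.
Qed.

End OrbitSpace.

Definition unity_space (B : {set J}) p g (rho : nat) : set (cspace R J) :=
  [set x | (forall a, a \notin B -> x a = 0) /\
     forall a b (d : C), a \in B -> b \in B -> d ^+ rho = 1 ->
       g a * x a = d * (g b * x b) <-> p a = d * p b].

(** If rho = 1, the relations are equalities between coordinates and say nothing about 0, which
    gives M(1, k). If there is a root of unity d <> 1, the relation of an index with itself through
    d prescribes where [x] vanishes, which gives M^sharp(rho, k). *)
Lemma arranged_unity_space D (B : {set J}) p g rho :
  (forall a, g a != 0) -> (0 < rho)%N ->
  (rho = 1%N \/ exists2 d : C, d ^+ rho = 1 & d != 1) ->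
  arranged R D (set_type (unity_space B p g rho)).
Proof.
move=> g0 rho_gt0 [rho1|[d0 d0rho d01]].
  (* Translating [p] preserves equalities between its coordinates; a generic [c] makes all of them
     non-zero, so that the model forces no zeros. *)
  have [c cP] := exists_notin_seq [seq - p a | a <- enum J].
  pose p' a := p a + c.
  have p'0 a : p' a != 0.
    rewrite /p' addr_eq0 -eqr_oppLR; apply: contraNneq cP => <-.
    by apply/mapP; exists a; rewrite ?mem_enum.
  have -> : unity_space B p g rho = orbit_space B p' g rho finset.set0.
    rewrite rho1; apply/predeqP => x; split=> [[x0 xB]|[x0 _ xE xD _]].
      split=> //.
      - by move=> a _ /eqP; rewrite (negPf (p'0 a)).
      - move=> a b aB bB _; rewrite !expr1 => ab; rewrite ab divff // mul1r.
        rewrite -[RHS]mul1r; apply/(xB a b 1 aB bB (expr1 _)).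
        by rewrite mul1r; exact: addIr ab.
      - move=> a b aB bB _ _; rewrite !expr1; apply: contra_neq => ab.
        congr (_ + _); rewrite -[RHS]mul1r; apply/(xB a b 1 aB bB (expr1 _)).
        by rewrite mul1r.
      - by move=> a _; rewrite inE.
    split=> // a b d aB bB; rewrite expr1 => ->; rewrite !mul1r; split=> ab.
      apply: (addIr c); apply/eqP; apply: contra_eqT ab => ab.
      by have := xD a b aB bB (p'0 a) (p'0 b); rewrite !expr1; exact.
    have := xE a b aB bB (p'0 b); rewrite !expr1 => ->; rewrite /p' ab //.
    by rewrite divff ?mul1r //; exact: p'0.
  apply: arranged_homeo (homeomorphic_orbit_space g0 rho_gt0 _) _.
    by move=> a b _ _; rewrite inE.
  by rewrite finset.setI0; exact: arranged_configuration0.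
have -> : unity_space B p g rho = orbit_space B p g rho [set: J].
  apply/predeqP => x; split=> [[x0 xB]|[x0 xp0 xE xD xN]].
    (* Vanishing of a number u is the relation u = d0 u, and such relations are shared by [x] and
       [p]. *)
    have xz a : a \in B -> x a = 0 <-> p a = 0.
      move=> aB; have fixed (u : C) : u = d0 * u <-> u = 0.
        split=> [/eqP|->]; last by rewrite mulr0.
        rewrite -[X in X == _]mul1r -subr_eq0 -mulrBl mulf_eq0 subr_eq0.
        by rewrite eq_sym (negPf d01) => /eqP.
      rewrite -(fixed (p a)) -(xB a a d0 aB aB d0rho) fixed.
      split=> [->|/eqP]; first by rewrite mulr0.
      by rewrite mulf_eq0 (negPf (g0 a)) => /eqP.
    split=> //.
    - by move=> a aB /xz; exact.
    - move=> a b aB bB pb ab; apply/xB => //; last by rewrite divfK.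
      by rewrite expr_div_n ab divff // expf_neq0.
    - move=> a b aB bB pa pb; apply: contra_neq =>
        /(eq_expr_unity rho_gt0)[d d1].
      by move/xB => -> //; rewrite exprMn d1 mul1r.
    - by move=> a aB _; apply: contra_neq => /xz; exact.
  have xz a : a \in B -> g a * x a = 0 -> p a = 0.
    move=> aB /eqP; rewrite mulf_eq0 (negPf (g0 a)) /= => xa.
    by apply/eqP; apply: contraTT xa => pa; apply: xN; rewrite ?inE.
  split=> // a b d aB bB d1; have d_neq0 : d != 0.
    by apply: contra_eq_neq d1 => ->; rewrite expr0n gtn_eqF // eq_sym oner_eq0.
  have [pb|pb] := eqVneq (p b) 0.
    rewrite pb (xp0 b bB pb) !mulr0; split; first exact: xz.
    by move/(xp0 a aB) => ->; rewrite mulr0.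
  have [pa|pa] := eqVneq (p a) 0.
    rewrite pa (xp0 a aB pa) mulr0; split=> /esym/eqP;
      rewrite mulf_eq0 (negPf d_neq0).
      by move=> /eqP /(xz _ bB) /eqP; rewrite (negPf pb).
    by rewrite (negPf pb).
  split=> ab.
    have : p a ^+ rho = p b ^+ rho.
      apply/eqP; apply: contraT => pab.
      by have := xD a b aB bB pa pb pab; rewrite ab exprMn d1 mul1r eqxx.
    move=> /(xE a b aB bB pb); rewrite ab => /mulIf ->; first by rewrite divfK.
    by rewrite mulf_neq0 // xN ?inE.
  have -> : d = p a / p b by rewrite ab mulfK.
  by apply: xE => //; rewrite ab exprMn d1 mul1r.
apply: arranged_homeo (homeomorphic_orbit_space g0 rho_gt0 _) _.
  by move=> a b _ _ _ _; rewrite inE.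
by rewrite finset.setIT; exact: arranged_configurationT.
Qed.

End Orbits.

(** * Decomposition into blocks *)

Section Levels.
Variables (R : realType) (J : finType).
Local Notation C := R[i]^o.
Implicit Types (x y : cspace R J) (a b : J).

Lemma arranged_levels D s (L : 'I_s -> set (cspace R J)) :
  (forall i, arranged R D (set_type (L i))) ->
  arranged R D (set_type
    [set x : cspace R (J * 'I_s) | forall i, L i (fun a => x (a, i))]).
Proof.
move=> Larr; apply: (@arranged_blocks R _ D _ snd
  (fun i => [set x : cspace R (J * 'I_s) | L i (fun a => x (a, i))])).
  move=> i x y xy /=; congr (L i _); apply/funext => a; exact: xy.
move=> i; apply: arranged_homeo (Larr i).
apply: (homeomorphic_sets
  (@continuous_monomial R (J * 'I_s) J (fun=> 1) (fun a => (a, i)))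
  (@continuous_monomial R J (J * 'I_s) (fun ai => (ai.2 == i)%:R) fst)).
- by move=> x [_ /=]; congr (L i _); apply/funext => a; rewrite mul1r.
- move=> y Ly; split=> [a /negPf /= ->|/=]; first by rewrite mul0r.
  by move: Ly; congr (L i _); apply/funext => a; rewrite eqxx mul1r.
- move=> x [xs _]; apply/funext => -[a j] /=.
  case: (eqVneq j i) => [->|ji]; first by rewrite !mul1r.
  by rewrite mul0r xs.
- by move=> y _; apply/funext => a /=; rewrite eqxx !mul1r.
Qed.

Section Level.
Variables (q : J -> C) (G : J -> J -> C -> Prop) (m : nat).
Hypotheses (m_gt0 : (0 < m)%N)
  (G_refl : forall a, G a a 1)
  (G_sym : forall a b w, G a b w -> G b a w^-1)
  (G_trans : forall a b c v w, G a b v -> G b c w -> G a c (v * w))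
  (G_unity : forall a w, G a a w -> w ^+ m = 1).

Variables (Z : {set J}) (S : set (cspace R J)).
Hypotheses (GZ : forall a b w, G a b w -> (a \in Z) = (b \in Z))
  (S_local : local_on (fun a => a \in Z) S).

(** [G] is a groupoid on the indices, with factors [w] as arrows. Outside [Z] the vector [x]
    satisfies the same relations as [q]; on [Z], a union of orbits, a separate condition [S] is
    imposed. *)
Definition level_space : set (cspace R J) :=
  [set x | S x /\ forall a b w, a \notin Z -> b \notin Z -> G a b w ->
     x a = w * x b <-> q a = w * q b].

Definition linked a b := `[< exists w, G a b w >].

(** [None] names the block [Z]; any other block is an orbit of the groupoid, named by a chosen
    element. *)
Definition level_block a : option J :=
  if a \in Z then None else Some (odflt a [pick b | linked b a]).

(** Going from [a] to [b] and back gives the factor w / w, whose m-th power is 1; it would be 0 if w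
    were 0. *)
Lemma G_neq0 a b w : G a b w -> w != 0.
Proof.
move=> Gab; have := G_unity (G_trans Gab (G_sym Gab)).
apply: contra_eq_neq => ->; rewrite mul0r expr0n gtn_eqF //.
by rewrite eq_sym oner_eq0.
Qed.

Lemma linkedP a b : reflect (exists w, G a b w) (linked a b).
Proof. exact: asboolP. Qed.

Lemma linked_sym a b : linked a b -> linked b a.
Proof. by move=> /linkedP[w /G_sym Gba]; apply/linkedP; exists w^-1. Qed.

Lemma linked_trans a b c : linked a b -> linked b c -> linked a c.
Proof.
move=> /linkedP[v Gab] /linkedP[w Gbc]; apply/linkedP.
by exists (v * w); exact: G_trans Gbc.
Qed.

Lemma level_blockP a k : level_block a = Some k -> linked k a.
Proof.
rewrite /level_block; case: ifP => // _ [<-]; case: pickP => //= _.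
by apply/linkedP; exists 1.
Qed.

Lemma level_block_notin a k : level_block a = Some k -> a \notin Z.
Proof. by rewrite /level_block; case: ifP. Qed.

Lemma eq_level_block a b : linked a b -> level_block a = level_block b.
Proof.
move=> ab; have [w Gab] := linkedP _ _ ab; rewrite /level_block (GZ Gab).
case: ifP => // _; congr Some.
have -> : [pick c | linked c a] = [pick c | linked c b].
  apply: eq_pick => c; apply/idP/idP => /linked_trans; apply => //.
  exact: linked_sym.
by case: pickP => //= /(_ b); rewrite (linked_trans (linked_sym ab) ab).
Qed.

(** Transporting all indices of the block to [k] turns each relation into one whose factor
    stabilises [k], and the stabiliser is a group of rho-th roots of unity. *)
Lemma arranged_level_block D k : arranged R D (set_type
  (supported (fun a => level_block a == Some k) `&`
   [set x | forall a b w, level_block a = Some k -> level_block b = Some k ->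
      G a b w -> x a = w * x b <-> q a = w * q b])).
Proof.
have [rho rho_gt0 [rhoP rho_cases]] :=
  unity_subgroup m_gt0 (G_refl k) (@G_trans k k k) (@G_unity k).
pose B : {set J} := [set a | level_block a == Some k]%SET.
(* [g a] is a factor from [k] to [a]; the value 1 outside the block keeps [g] non-zero
   everywhere. *)
have /choice[g gP] a : exists w, w != 0 /\ (a \in B -> G k a w).
  have [aB|] := boolP (a \in B); last by exists 1; rewrite oner_neq0.
  move: (aB); rewrite inE => /eqP /level_blockP /linkedP[w Gkw].
  by exists w; split=> //; exact: G_neq0 Gkw.
have g0 a : g a != 0 by have [] := gP a.
(* The factor [g a * w / g b] is that of the loop at [k] passing through [a] and [b]. *)
have eqg (x : J -> C) a b w : x a = w * x b <->
    g a * x a = g a * w / g b * (g b * x b).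
  rewrite mulrA divfK // -mulrA.
  by split=> [->|] //; apply: mulfI.
rewrite (_ : _ `&` _ = unity_space B (fun a => g a * q a) g rho); last first.
  apply/predeqP => x; split=> [[x0 xB]|[x0 xB]]; split.
  - by move=> a; rewrite inE; exact: x0.
  - move=> a b d aB bB /rhoP Gd.
    have Gab : G a b ((g a)^-1 * d * g b).
      apply: G_trans (G_trans (G_sym (proj2 (gP a) aB)) Gd) _.
      exact: (proj2 (gP b) bB).
    have dE : d = g a * ((g a)^-1 * d * g b) / g b.
      by rewrite !mulrA divff // mul1r mulfK.
    rewrite {1 2}dE -!eqg; apply: xB => //.
      by move: aB; rewrite inE => /eqP.
    by move: bB; rewrite inE => /eqP.
  - by move=> a ak; apply: x0; rewrite inE.
  - move=> a b w ak bk Gab.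
    have aB : a \in B by rewrite inE ak.
    have bB : b \in B by rewrite inE bk.
    rewrite (eqg x) (eqg q); apply: xB => //; apply/rhoP.
    apply: G_trans (G_trans (proj2 (gP a) aB) Gab) _.
    exact: G_sym (proj2 (gP b) bB).
exact: arranged_unity_space.
Qed.

Lemma arranged_level D :
  arranged R D (set_type (supported (fun a => a \in Z) `&` S)) ->
  arranged R D (set_type level_space).
Proof.
move=> Sarr.
pose P (k : option J) : set (cspace R J) := if k is Some k then
  [set x | forall a b w, level_block a = Some k -> level_block b = Some k ->
      G a b w -> x a = w * x b <-> q a = w * q b] else S.
have bZ a : (level_block a == None) = (a \in Z).
  by rewrite /level_block; case: ifP.
rewrite (_ : level_space = [set x | forall k, P k x]).
  apply: (@arranged_blocks R J D _ level_block) => -[k|].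
  - move=> x y xy Px a b w ak bk Gab.
    by rewrite -!xy ?ak ?bk //; exact: Px.
  - by move=> x y xy; apply: S_local => a aZ; apply: xy; rewrite bZ.
  - exact: arranged_level_block.
  - rewrite (_ : (fun a => level_block a == None) = (fun a => a \in Z)) //.
    exact/funext.
apply/predeqP => x; split=> [[Sx xG] [k|//] a b w ak bk|Px].
  by apply: xG; [exact: level_block_notin ak|exact: level_block_notin bk].
split; first exact: (Px None).
move=> a b w aZ bZ' Gab; have [k ak] : exists k, level_block a = Some k.
  by rewrite /level_block (negPf aZ); eexists.
have ab : linked a b by apply/linkedP; exists w.
by apply: (Px (Some k)) Gab; rewrite -?(eq_level_block ab).
Qed.

End Level.

End Levels.

(** * Coefficients of sum zero *)

Section SpecialLevels.
Variables (R : realType) (J : finType).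
Local Notation C := R[i]^o.
Implicit Types (x y : cspace R J) (a b : J).

Section SumZero.
Variables (q : J -> C) (G : J -> J -> C -> Prop) (m : nat).
Hypotheses (m_gt0 : (0 < m)%N)
  (G_refl : forall a, G a a 1)
  (G_sym : forall a b w, G a b w -> G b a w^-1)
  (G_trans : forall a b c v w, G a b v -> G b c w -> G a c (v * w))
  (G_unity : forall a w, G a a w -> w ^+ m = 1).

Lemma arranged_full_level D : arranged R D (set_type
  [set x : cspace R J | forall a b w, G a b w ->
      x a = w * x b <-> q a = w * q b]).
Proof.
rewrite (_ : [set x | _] = level_space q G finset.set0 setT); last first.
  apply/predeqP => x; split=> [xG|[_ xG] a b w]; last by apply: xG; rewrite inE.
  by split=> // a b w _ _; exact: xG.
apply: (arranged_level q m_gt0) => //.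
  by move=> a b w _; rewrite !inE.
apply: arranged_singleton.
have x0P : (fun=> 0 : C) \in (supported (fun a => a \in finset.set0) `&`
    [set: cspace R J]) by apply/mem_set; split.
exists (exist _ (fun=> 0 : C) x0P) => -[x xP]; apply: val_inj => /=.
by apply/funext => a; have [xs _] := set_mem xP; apply: xs; rewrite inE.
Qed.

Variables (sigma : {perm J}) (z : C) (b0 : J).
Hypotheses (G_sigma : forall a, G (sigma a) a z)
  (q_sigma : forall a, q (sigma a) = z * q a)
  (G1 : z = 1 -> forall a b w, G a b w -> w = 1).

(** With the value at [b0] fixed to 0, the other distinct values on the block are non-zero.
    Subtracting [q b0] from [q] gives a model with its zeros in the right places. *)
Lemma arranged_sum0_base D (B : {set J}) : b0 \in B ->
  (forall a b, a \in B -> b \in B -> G a b 1) -> z = 1 ->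
  arranged R D (set_type (supported (fun a => a \in B) `&`
    [set x : cspace R J | x b0 = 0 /\ forall a b w, a \in B -> b \in B ->
       G a b w -> x a = w * x b <-> q a = w * q b])).
Proof.
move=> b0B BG z1; pose p a := q a - q b0.
rewrite (_ : _ `&` _ = orbit_space B p (fun=> 1) 1 [set: J]).
  have one_neq0 (a : J) : (1 : C) != 0 by exact: oner_neq0.
  apply: arranged_homeo (homeomorphic_orbit_space one_neq0 (ltn0Sn 0) _) _.
    by move=> a b _ _ _ _; rewrite inE.
  by rewrite finset.setIT; exact: arranged_configurationT.
apply/predeqP => x; split=> [[x0 [xb0 xB]]|[x0 xp0 xE xD xN]].
  have xB1 a b : a \in B -> b \in B -> x a = x b <-> q a = q b.
    by move=> aB bB; have := xB a b 1 aB bB (BG _ _ aB bB); rewrite !mul1r.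
  split=> //.
  - by move=> a aB /eqP; rewrite subr_eq0 => /eqP /(xB1 a b0 aB b0B) ->.
  - move=> a b aB bB pb; rewrite !expr1 !mul1r => ab; rewrite ab divff // mul1r.
    by apply/xB1 => //; exact: addIr ab.
  - move=> a b aB bB _ _; rewrite !expr1 !mul1r; apply: contra_neq => /xB1 ab.
    by rewrite /p ab.
  - move=> a aB _; apply: contra_neq => xa.
    apply/eqP; rewrite subr_eq0; apply/eqP/xB1 => //.
    by rewrite xa xb0.
split=> //; split; first by apply: xp0 => //; rewrite /p subrr.
move=> a b w aB bB /(G1 z1) ->; rewrite !mul1r.
have xz c : c \in B -> x c = 0 -> p c = 0.
  by move=> cB xc; apply/eqP; apply: contraTT (eqxx (0 : C)) => pc;
    rewrite -{1}xc; apply: xN; rewrite ?inE.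
have qp : q a = q b <-> p a = p b by split=> [|/addIr//]; rewrite /p => ->.
rewrite qp; have [pb|pb] := eqVneq (p b) 0.
  by rewrite pb (xp0 b bB pb); split=> [/xz|/xp0]; exact.
have [pa|pa] := eqVneq (p a) 0.
  rewrite pa (xp0 a aB pa); split=> /esym; last by move/eqP; rewrite (negPf pb).
  by move/xz => /(_ bB) /eqP; rewrite (negPf pb).
split=> ab.
  apply/eqP; apply: contraT => pab.
  by have := xD a b aB bB pa pb pab; rewrite !expr1 !mul1r ab eqxx.
by have := xE a b aB bB pb; rewrite !expr1 ab divff // !mul1r; exact.
Qed.

(* If [z != 1] the sum vanishes automatically; if [z = 1], translating one
   block trades the condition on the sum for the vanishing of one coordinate
   of that block. *)
Lemma arranged_sum0_level D : arranged R D (set_type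
  [set x : cspace R J | \sum_a x a = 0 /\
     forall a b w, G a b w -> x a = w * x b <-> q a = w * q b]).
Proof.
have [z1|z1] := eqVneq z 1; last first.
  rewrite (_ : [set x | _] = [set x : cspace R J |
      forall a b w, G a b w -> x a = w * x b <-> q a = w * q b]).
    exact: arranged_full_level.
  apply/predeqP => x; split=> [[]//|xG]; split=> //.
  (* The permutation [sigma] multiplies the coordinates by [z] and preserves their sum. *)
  have xs : \sum_a x a = z * \sum_a x a.
    rewrite [LHS](reindex_inj (@perm_inj _ sigma)) /= mulr_sumr.
    by apply: eq_bigr => a _; apply/(xG _ _ _ (G_sigma a)).
  move/eqP: xs; rewrite -[X in X == _]mul1r -subr_eq0 -mulrBl mulf_eq0 subr_eq0.
  by rewrite eq_sym (negPf z1) => /eqP.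
pose B : {set J} := [set a | linked G b0 a]%SET.
have BP a : a \in B <-> G b0 a 1.
  rewrite inE; split=> [/linkedP[w Gw]|Ga]; last by apply/linkedP; exists 1.
  by rewrite -(G1 z1 Gw).
have b0B : b0 \in B by apply/BP.
have BG a b : a \in B -> b \in B -> G a b 1.
  move=> /BP/G_sym; rewrite invr1 => Ga /BP Gb.
  by have := G_trans Ga Gb; rewrite mul1r.
have GB a b w : G a b w -> (a \in B) = (b \in B).
  move=> Gab; have w1 := G1 z1 Gab; move: Gab; rewrite w1 => Gab.
  apply/idP/idP => /BP G0; apply/BP.
    by have := G_trans G0 Gab; rewrite mul1r.
  by have := G_trans G0 (G_sym Gab); rewrite invr1 mul1r.
pose S : set (cspace R J) := [set x | x b0 = 0 /\ forall a b w, a \in B ->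
  b \in B -> G a b w -> x a = w * x b <-> q a = w * q b].
have Barr : arranged R D (set_type (supported (fun a => a \in B) `&` S)).
  exact: arranged_sum0_base.
suff SH : homeomorphic (set_type [set x : cspace R J | \sum_a x a = 0 /\
     forall a b w, G a b w -> x a = w * x b <-> q a = w * q b])
    (set_type (level_space q G B S)).
  apply: arranged_homeo SH _; apply: (arranged_level q m_gt0) => //.
  move=> x y xy [xb0 xB]; split; first by rewrite -xy.
  by move=> a b w aB bB; rewrite -!xy //; exact: xB.
have B0 : #|B|%:R != 0 :> C.
  by rewrite pnatr_eq0 -lt0n; apply/card_gt0P; exists b0.
have shift (x : cspace R J) (c : C) a b w : G a b w ->
    x a - (a \in B)%:R * c = w * (x b - (b \in B)%:R * c) <-> x a = w * x b.
  move=> Gab; rewrite (G1 z1 Gab) !mul1r (GB _ _ _ Gab); split=> [|->//].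
  exact: addIr.
(* Both maps translate the block [B] and fix the other coordinates: [f] makes the value at [b0]
   vanish, and [f'] spreads the total sum evenly over the block to make it vanish. *)
pose f (x : cspace R J) : cspace R J := fun a => x a - (a \in B)%:R * x b0.
pose f' (x : cspace R J) : cspace R J :=
  fun a => x a - (a \in B)%:R * ((\sum_b x b) / #|B|%:R).
have sumB (c : C) : \sum_a (a \in B)%:R * c = #|B|%:R * c.
  rewrite -mulr_suml -sum1_card natr_sum [in RHS]big_mkcond; congr (_ * _).
  by apply: eq_bigr => a _; case: (a \in B).
apply: (@homeomorphic_sets _ _ _ _ f f').
- apply: continuous_prod_topology => a.
  rewrite (_ : (fun x => _) = fun x : cspace R J =>
      x a + (- (a \in B)%:R) * x b0); last first.
    by apply/funext => x; rewrite /f mulNr.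
  apply: continuous_add; first exact: continuous_coord.
  exact/continuous_scale/continuous_coord.
- apply: continuous_prod_topology => a.
  rewrite (_ : (fun x => _) = fun x : cspace R J =>
      x a + (- (a \in B)%:R / #|B|%:R) * \sum_b x b); last first.
    by apply/funext => x; rewrite /f' !mulNr mulrAC mulrA.
  apply: continuous_add; first exact: continuous_coord.
  by apply/continuous_scale/continuous_sum => b; exact: continuous_coord.
- move=> x [xs xG]; split; first split.
  + by rewrite /f b0B mul1r subrr.
  + by move=> a b w _ _ Gab; rewrite /f shift //; exact: xG.
  + by move=> a b w _ _ Gab; rewrite /f shift //; exact: xG.
- move=> y [[yb0 yB] yG]; split.
    rewrite /f' big_split /= sumrN sumB [X in _ - X]mulrC divfK //.
    by rewrite subrr.
  move=> a b w Gab; rewrite /f' shift //.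
  have [aB|aB] := boolP (a \in B).
    by apply: yB => //; rewrite -(GB _ _ _ Gab).
  by apply: yG => //; rewrite -(GB _ _ _ Gab).
- move=> x [xs xG]; apply/funext => a; rewrite /f' /f.
  rewrite big_split /= sumrN sumB xs add0r mulNr [_ / _]mulrAC divff // mul1r.
  by rewrite mulrN opprK subrK.
- move=> y [[yb0 yB] yG]; apply/funext => a; rewrite /f /f'.
  by rewrite b0B yb0 mul1r add0r mulrN opprK subrK.
Qed.

End SumZero.

End SpecialLevels.

(** * The zero block in type D *)

Section SignedPermutations.
Variables (R : realType) (J : finType).
Local Notation C := R[i]^o.
Implicit Types (x y : cspace R J) (a b : J).
Variables (sigma : {perm J}) (eps : J -> bool).

(** The equation w(x) = z x on the coordinates in [Z], for the signed permutation w given by [sigma]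
    and [eps]. *)
Definition equivariant (Z : {set J}) (z : C) x :=
  forall a, a \in Z -> z * x a = (-1) ^+ eps a * x (sigma a).

(** Powers of [z] are absorbed by moving the index along [sigma]. The index [b] and the sign [u] do
    not depend on [z] and [x], so the same pair serves for several vectors. *)
Lemma equivariant_iter (Z : {set J}) k a :
  (forall b, b \in Z -> sigma b \in Z) -> a \in Z ->
  exists b (u : bool), [/\ b \in Z, (forall a, eps a = false) -> u = false
    & forall z x, equivariant Z z x -> z ^+ k * x a = (-1) ^+ u * x b].
Proof.
move=> sZ aZ; elim: k => [|k [b [u [bZ eu xb]]]].
  by exists a, false; split=> // z x _; rewrite expr0.
exists (sigma b), (u (+) eps b); split.
- exact: sZ.
- by move=> e0; rewrite eu // e0.
- move=> z x xZ; rewrite exprS -mulrA xb // mulrCA xZ // signr_addb mulrA.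
  by [].
Qed.

Variables (Z : {set J}) (q : cspace R J) (z : C) (m : nat).
Hypotheses (sZ : forall a, a \in Z -> sigma a \in Z)
  (m_gt0 : (0 < m)%N) (zm : z ^+ m = 1) (qZ : equivariant Z z q).

(** The relations concern pairs of distinct indices, as 2 e_a is not a root in type D; the vanishing
    of a single coordinate is not prescribed. *)
Definition signed_space : set (cspace R J) :=
  [set x | equivariant Z z x /\ forall a b (u : bool), a \in Z -> b \in Z ->
     a != b -> x a = (-1) ^+ u * x b <-> q a = (-1) ^+ u * q b].

Lemma oppr_fixed (u : C) : u = - u <-> u = 0.
Proof.
split=> [|->]; last by rewrite oppr0.
by move/eqP; rewrite -addr_eq0 -mulr2n mulrn_eq0 => /eqP.
Qed.

Lemma equivariant_sigma x a : equivariant Z z x -> a \in Z ->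
  x (sigma a) = (-1) ^+ eps a * z * x a.
Proof. by move=> xZ aZ; rewrite -mulrA xZ // signrMK. Qed.

(** The situations in which the zeros of [x] are nevertheless the zeros of [q]: z is not a sign,
    equivariance kills the coordinate at a fixed index, or [q] vanishes at two indices. *)
Definition forced_zeros := [\/ z ^+ 2 != 1,
  exists2 a, a \in Z & sigma a = a /\ (-1) ^+ eps a * z != 1 |
  exists a b, [/\ a \in Z, b \in Z, a != b, q a = 0 & q b = 0]].

(** An index where both vectors vanish settles all others, by comparison with it. If z is not a
    sign, an index not fixed by [sigma] is compared with its image instead. *)
Lemma forced_zerosP x : forced_zeros -> signed_space x ->
  forall a, a \in Z -> x a = 0 <-> q a = 0.
Proof.
move=> forced [xZ xq].
have prop0 b : b \in Z -> x b = 0 -> q b = 0 ->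
    forall a, a \in Z -> x a = 0 <-> q a = 0.
  move=> bZ xb qb a aZ; have [->//|ab] := eqVneq a b.
  by have := xq a b false aZ bZ ab; rewrite xb qb !mulr0.
have fix0 y a : equivariant Z z y -> a \in Z -> sigma a = a ->
    (-1) ^+ eps a * z != 1 -> y a = 0.
  move=> yZ aZ sa za; have := equivariant_sigma yZ aZ; rewrite sa => /eqP.
  rewrite -[X in X == _]mul1r -subr_eq0 -mulrBl mulf_eq0 subr_eq0.
  by rewrite eq_sym (negPf za) => /eqP.
case: forced => [z2|[a aZ [sa za]]|[b [c [bZ cZ bc qb qc]]]].
- move=> a aZ; have [sa|sa] := eqVneq (sigma a) a.
    have za : (-1) ^+ eps a * z != 1.
      by apply: contraNneq z2 => za;
        rewrite -[z](signrMK (eps a)) za mulr1 -exprM muln2 -signr_odd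
          odd_double.
    by rewrite (fix0 x) // (fix0 q).
  (* If [y a] is 0, then so is [y (sigma a)], and these coordinates are related by both signs; the
     same two relations for [y'] give [y' a = - y' a]. *)
  have H y y' : equivariant Z z y -> equivariant Z z y' ->
      (forall u : bool, y (sigma a) = (-1) ^+ u * y a ->
         y' (sigma a) = (-1) ^+ u * y' a) -> y a = 0 -> y' a = 0.
    move=> yZ y'Z yy' ya.
    have ysa : y (sigma a) = 0 by rewrite equivariant_sigma // ya mulr0.
    have := yy' false; have := yy' true;
      rewrite ysa ya !mulr0 => -> // /(_ erefl).
    by rewrite expr0 expr1 mul1r mulN1r => /esym/oppr_fixed.
  have E u := xq (sigma a) a u (sZ aZ) aZ sa.
  by split; apply: H => // u /E.
- by apply: (prop0 a) => //; [exact: fix0|exact: fix0].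
- have xbc : x b = x c.
    by have := xq b c false bZ cZ bc; rewrite qb qc !mulr0 mul1r => ->.
  have xb : x b = 0.
    apply/oppr_fixed; rewrite {2}xbc.
    by have := xq b c true bZ cZ bc; rewrite qb qc !mulr0 expr1 mulN1r => ->.
  exact: (prop0 b).
Qed.

(** Once zeros are prescribed, equivariance and the relations up to sign amount to relations under
    the finite group of all signs times powers of [z]. *)
Lemma arranged_signed_forced D : forced_zeros ->
  arranged R D (set_type (supported (fun a => a \in Z) `&` signed_space)).
Proof.
move=> forced.
pose H (w : C) := exists k (u : bool), w = (-1) ^+ u * z ^+ k.
have [rho rho_gt0 [rhoP rho_cases]] : exists2 rho, (0 < rho)%N &
    (forall d, H d <-> d ^+ rho = 1) /\
    (rho = 1%N \/ exists2 d : C, d ^+ rho = 1 & d != 1).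
  apply: (@unity_subgroup R H (2 * m)); first by rewrite muln_gt0.
  - by exists 0%N, false; rewrite mul1r.
  - move=> _ _ [k [u ->]] [l [v ->]]; exists (k + l)%N, (u (+) v).
    by rewrite signr_addb exprD mulrACA.
  - move=> _ [k [u ->]]; rewrite exprMn [X in X * _]exprM sqrr_sign expr1n
      mul1r.
    by rewrite -exprM mulnA mulnC exprM zm expr1n.
rewrite (_ : _ `&` _ = unity_space Z q (fun=> 1) rho).
  by apply: arranged_unity_space => // a; exact: oner_neq0.
apply/predeqP => x; split=> [[x0 xs]|[x0 xq]].
  split=> // a b d aZ bZ /rhoP[k [u ->]]; rewrite !mul1r.
  have [c [v [cZ _ bc]]] := equivariant_iter k sZ bZ.
  have [xZ xq] := xs.
  rewrite -!mulrA !(bc z) // !mulrA -!signr_addb.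
  (* If the powers of [z] lead from [b] back to [a], the relation is trivial or expresses the
     vanishing of one coordinate. *)
  have [ac|] := eqVneq a c; last exact: xq.
  rewrite -ac; case: (u (+) v); rewrite ?expr1 ?mulN1r ?expr0 ?mul1r //.
  by rewrite !oppr_fixed; exact: forced_zerosP.
split=> //; split.
  move=> a aZ; have HE : H ((-1) ^+ eps a * z) by exists 1%N, (eps a).
  have := xq (sigma a) a _ (sZ aZ) aZ (proj1 (rhoP _) HE).
  rewrite !mul1r => -[_ ->]; last exact: equivariant_sigma.
  by rewrite -mulrA signrMK.
move=> a b u aZ bZ _; have HE : H ((-1) ^+ u) by exists 0%N, u; rewrite mulr1.
by have := xq a b _ aZ bZ (proj1 (rhoP _) HE); rewrite !mul1r.
Qed.

Lemma eq_sqr_sign (u v : C) :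
  u ^+ 2 = v ^+ 2 <-> exists s : bool, u = (-1) ^+ s * v.
Proof.
split=> [/eqP|[s ->]]; last by rewrite exprMn sqrr_sign mul1r.
rewrite eqf_sqr => /orP[]/eqP->; first by exists false; rewrite mul1r.
by exists true; rewrite mulN1r.
Qed.

(* A vanishing coordinate of [q] which is not forced to vanish behaves like a
   coordinate with a generic value. *)
Lemma arranged_signed_unforced (D : Prop) : D -> ~ forced_zeros ->
  arranged R D (set_type (supported (fun a => a \in Z) `&` signed_space)).
Proof.
move=> d unforced.
have z2 : z ^+ 2 = 1.
  by apply/eqP; apply: contraT => z2; case: unforced; apply: Or31.
have sfix a : a \in Z -> sigma a = a -> (-1) ^+ eps a * z = 1.
  move=> aZ sa; apply/eqP; apply: contraT => za.
  by case: unforced; apply: Or32; exists a.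
have [c cP] := exists_notin_seq
  (0 :: [seq q a | a <- enum J] ++ [seq - q a | a <- enum J]).
have c0 : c != 0 by apply: contraNneq cP => ->; exact: mem_head.
have cq (u : bool) a : c != (-1) ^+ u * q a.
  apply: contraNneq cP => ->; rewrite inE mem_cat; apply/orP; right.
  case: u; apply/orP; [right|left]; apply/mapP; exists a; rewrite ?mem_enum //.
    by rewrite mulN1r.
  by rewrite mul1r.
(* At most one coordinate in [Z] is replaced, two zeros being a forced case; as [c] differs from
   every [q a] up to sign, the relations between distinct indices are unchanged. *)
pose p a := if q a == 0 then c else q a.
have p0 a : p a != 0 by rewrite /p; case: ifPn.
have pq a b (u : bool) : a \in Z -> b \in Z -> a != b ->
    p a = (-1) ^+ u * p b <-> q a = (-1) ^+ u * q b.
  move=> aZ bZ ab; rewrite /p; case: eqVneq => qa; case: eqVneq => qb //.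
  - by case: unforced; apply: Or33; exists a, b.
  - split=> [/eqP|/eqP]; first by rewrite (negPf (cq _ _)).
    by rewrite qa eq_sym mulf_eq0 signr_eq0 (negPf qb).
  - split=> [qac|/eqP]; last by rewrite qb mulr0 (negPf qa).
    by have := cq u a; rewrite qac signrMK eqxx.
(* These indices share their value up to sign with another index. A zero there would satisfy the
   relations of both signs, so it is excluded; the values at other indices may vanish. *)
pose N : {set J} := [set a in Z |
  [exists b in Z, (b != a) && (p b ^+ 2 == p a ^+ 2)]]%SET.
have NP a : reflect (a \in Z /\
  exists b, [/\ b \in Z, b != a & p b ^+ 2 = p a ^+ 2]) (a \in N).
  rewrite inE; apply: (iffP andP) => -[aZ].
    by move=> /existsP[b /and3P[bZ ba /eqP pb]]; split=> //; exists b.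
  by move=> [b [bZ ba pb]]; split=> //; apply/existsP; exists b;
    rewrite bZ ba pb /=.
rewrite (_ : _ `&` _ = orbit_space Z p (fun=> 1) 2 N).
  have one_neq0 (a : J) : (1 : C) != 0 by exact: oner_neq0.
  apply: arranged_homeo (homeomorphic_orbit_space one_neq0 (ltn0Sn 1) _) _.
    move=> a b aZ bZ /NP[_ [e [eZ ea pe]]] pab; apply/NP; split=> //.
    have [eb|eb] := eqVneq e b; last by exists e; rewrite -pab.
    by exists a; rewrite -eb eq_sym.
  by apply: arranged_configuration2 => //; exact: finset.subsetIl.
apply/predeqP => x; split=> [[x0 [xZ xq]]|[x0 _ xE xD xN]].
  have xp a b (u : bool) (aZ : a \in Z) (bZ : b \in Z) (ab : a != b) :
      x a = (-1) ^+ u * x b <-> p a = (-1) ^+ u * p b.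
    exact: (iff_trans (xq a b u aZ bZ ab) (iff_sym (pq a b u aZ bZ ab))).
  split=> //.
  - by move=> a _ /eqP; rewrite (negPf (p0 a)).
  - move=> a b aZ bZ _ /eq_sqr_sign[s ps]; rewrite !mul1r.
    have [->|ab] := eqVneq a b; first by rewrite divff // mul1r.
    by rewrite ps mulfK //; apply/xp.
  - move=> a b aZ bZ _ _; rewrite !mul1r => pab; apply/eqP => /eq_sqr_sign[s].
    have ab : a != b by apply: contra_neq pab => ->.
    move/(xp a b s aZ bZ ab) => ps; move/eqP: pab; apply.
    by apply/eq_sqr_sign; exists s.
  - move=> a aZ /NP[_ [b [bZ ba /eq_sqr_sign[s ps]]]] _; apply/eqP => xa.
    have xb : x b = 0 by rewrite ((xp b a s bZ aZ ba).2 ps) xa mulr0.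
    have /(xp b a (~~ s) bZ aZ ba) : x b = (-1) ^+ (~~ s) * x a.
      by rewrite xb xa mulr0.
    rewrite ps signrN mulNr => /oppr_fixed/eqP.
    by rewrite mulf_eq0 signr_eq0 (negPf (p0 a)).
have xp a b (u : bool) : a \in Z -> b \in Z -> a != b ->
    x a = (-1) ^+ u * x b <-> p a = (-1) ^+ u * p b.
  move=> aZ bZ ab; split=> [xab|pab].
    have pab : p a ^+ 2 = p b ^+ 2.
      apply/eqP; apply: contraT => pab.
      have := xD a b aZ bZ (p0 a) (p0 b) pab.
      by rewrite xab !mul1r exprMn sqrr_sign mul1r eqxx.
    have xb : x b != 0 by apply: xN => //; apply/NP; split=> //; exists a.
    have := xE a b aZ bZ (p0 b) pab; rewrite !mul1r xab => /(mulIf xb) ->.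
    by rewrite divfK.
  have p2 : p a ^+ 2 = p b ^+ 2 by apply/eq_sqr_sign; exists u.
  by have := xE a b aZ bZ (p0 b) p2; rewrite !mul1r pab mulfK.
split; first by [].
have xq a b (u : bool) (aZ : a \in Z) (bZ : b \in Z) (ab : a != b) :
    x a = (-1) ^+ u * x b <-> q a = (-1) ^+ u * q b.
  exact: (iff_trans (xp a b u aZ bZ ab) (pq a b u aZ bZ ab)).
(* At a fixed index equivariance is vacuous in the unforced case; elsewhere [z] is a sign, and
   equivariance is one of the relations between distinct indices. *)
split=> // a aZ; have [sa|sa] := eqVneq (sigma a) a.
  by rewrite sa -[z](signrMK (eps a)) sfix // mulr1.
have [s zs] : exists s : bool, z = (-1) ^+ s.
  have /eq_sqr_sign[s] : z ^+ 2 = 1 ^+ 2 by rewrite expr1n.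
  by rewrite mulr1; exists s.
have : x (sigma a) = (-1) ^+ (eps a (+) s) * x a.
  apply/xq => //; first exact: sZ.
  by rewrite equivariant_sigma // zs -signr_addb.
by move=> ->; rewrite signr_addb -mulrA signrMK zs.
Qed.

Lemma arranged_signed_space (D : Prop) : D ->
  arranged R D (set_type (supported (fun a => a \in Z) `&` signed_space)).
Proof.
move=> d; have [forced|unforced] := pselect forced_zeros.
  exact: arranged_signed_forced.
exact: arranged_signed_unforced.
Qed.

End SignedPermutations.

(** * Weyl groups of classical type *)

Section WeylGroup.
Variables (R : realType) (T : vectType R[i]).
Local Notation C := R[i]^o.
Implicit Types (a b : 'Hom(T, C)) (h : T).

(* If both [h1] and [h2] are coroots of [a], the product of the corresponding
   reflections is unipotent; it preserves a finite set, hence is trivial. *)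
Lemma coroot_unique (Phi : set 'Hom(T, C)) a h1 h2 :
  finite_set Phi -> (forall h, (forall b, Phi b -> b h = 0) -> h = 0) ->
  a h1 = 2%:R -> a h2 = 2%:R ->
  (forall b, Phi b -> Phi (b - (b h1 : R[i]) *: a)) ->
  (forall b, Phi b -> Phi (b - (b h2 : R[i]) *: a)) -> h1 = h2.
Proof.
move=> Phi_fin sep a1 a2 P1 P2; apply/eqP; rewrite -subr_eq0; apply/eqP.
apply: sep => b Pb; set v := h1 - h2.
have av : a v = 0 by rewrite linearB /= a1 a2 subrr.
have step c : Phi c -> Phi (c + (c v : R[i]) *: a).
  move=> /P1 /P2.
  have -> : (c - (c h1 : R[i]) *: a) h2 = c h2 - c h1 * 2%:R :> C.
    by rewrite add_lfunE opp_lfunE scale_lfunE a2.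
  have -> : c v = c h1 - c h2 :> C by rewrite linearB.
  rewrite -addrA -opprD -scalerDl -scaleNr; congr (Phi (_ + _ *: _)).
  by rewrite mulr_natr mulr2n; ring.
have iter k : Phi (b + (b v *+ k : R[i]) *: a).
  elim: k => [|k /step]; first by rewrite mulr0n scale0r addr0.
  have -> : (b + (b v *+ k : R[i]) *: a) v = b v :> C.
    by rewrite add_lfunE scale_lfunE av scaler0 addr0.
  by rewrite -addrA -scalerDl -mulrSr.
apply/eqP; apply: contraT => bv.
have : infinite_set [set: nat] by exact: infinite_nat.
case; apply: sub_finite_set (finite_preimage _ Phi_fin); first by move=> k _;
  exact: iter k.
move=> k l _ _ /addrI /lfunP /(_ h1).
rewrite !scale_lfunE a1 /GRing.scale /= => /eqP.
rewrite -subr_eq0 -mulrBl mulf_eq0 pnatr_eq0 orbF subr_eq0.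
by move=> /eqP; apply: mulrIn.
Qed.

Lemma classical_root_cases (X : classical_type) n
    (e : 'I_(ncoord X n) -> 'Hom(T, C)) a : classical_root X e a ->
  [\/ X = TypeA /\ (exists i j, i != j /\ a = e i - e j),
      X <> TypeA /\ (exists i j (u v : bool),
         i != j /\ a = (-1) ^+ u *: e i + (-1) ^+ v *: e j),
      X = TypeB /\ (exists i (u : bool), a = (-1) ^+ u *: e i)
    | X = TypeC /\ (exists i (u : bool), a = ((-1) ^+ u * 2%:R) *: e i)].
Proof.
case: X e => e /= H; [exact: Or41|..|exact: Or42].
  by case: H => H; [exact: Or42|exact: Or43].
by case: H => H; [exact: Or42|exact: Or44].
Qed.

Section ClassicalRoots.
Variables (X : classical_type) (n : nat) (Phi : set 'Hom(T, C)).
Local Notation N := (ncoord X n).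
Variable e : 'I_N -> 'Hom(T, C).
Hypotheses (rankP : simple_rank X n)
  (e_sum : X = TypeA -> forall h : T, \sum_i (e i h : R[i]) = 0)
  (e_coord : forall x : 'I_N -> R[i], (X = TypeA -> \sum_i x i = 0) ->
     exists! h : T, forall i, e i h = x i)
  (PhiE : forall a, Phi a <-> classical_root X e a).

Lemma coord_inj h h' : (forall i, e i h = e i h') -> h = h'.
Proof.
move=> hh'; have [] := e_coord (x := fun i => e i h); first by move/e_sum;
  exact.
by move=> g [_ gU]; rewrite -(gU h) // -(gU h').
Qed.

Lemma coord_ex (x : 'I_N -> C) : (X = TypeA -> \sum_i x i = 0) ->
  exists h : T, forall i, e i h = x i.
Proof. by move=> /e_coord[h [hx _]]; exists h. Qed.

Lemma root_neg i j : i != j -> Phi (e i - e j).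
Proof.
move=> ij; have D : exists (i' j' : 'I_N) (u v : bool),
    i' != j' /\ e i - e j = (-1) ^+ u *: e i' + (-1) ^+ v *: e j'.
  by exists i, j, false, true; rewrite expr0 expr1 scale1r scaleN1r.
by apply/PhiE; case: X e i j ij D => e' i j ij D //=; [exists i, j|left|left].
Qed.

Lemma root_pos i j : X <> TypeA -> i != j -> Phi (e i + e j).
Proof.
move=> nA ij; have D : exists (i' j' : 'I_N) (u v : bool),
    i' != j' /\ e i + e j = (-1) ^+ u *: e i' + (-1) ^+ v *: e j'.
  by exists i, j, false, false; rewrite expr0 !scale1r.
by apply/PhiE; case: X nA e i j ij D => nA e' i j ij D //=; [left|left].
Qed.

Lemma root_single i : X = TypeB \/ X = TypeC ->
  exists2 c : C, c != 0 & Phi ((c : R[i]) *: e i).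
Proof.
move=> BC; suff [c c0 Pc] : exists2 c : C, c != 0 &
    classical_root X e ((c : R[i]) *: e i) by exists c => //; apply/PhiE.
case: X BC e i => -[] // _ e' i.
- exists 1; first exact: oner_neq0.
  by right; exists i, false; rewrite expr0.
- exists 2%:R; first by rewrite pnatr_eq0.
  by right; exists i, false; rewrite expr0 mul1r.
Qed.

(** In types B and C a multiple of each coordinate is a root. In types A and D the differences make
    all coordinates equal; then the zero sum, respectively a root e_i + e_j, makes them vanish. *)
Lemma roots_separate h : (forall b, Phi b -> b h = 0) -> h = 0.
Proof.
move=> Ph; apply: coord_inj => i; rewrite linear0.
have nBC : (X = TypeB \/ X = TypeC) \/ (X = TypeA \/ X = TypeD).
  by case: X; tauto.
have [/(root_single i)[c c0 /Ph]|AD] := nBC.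
  by rewrite scale_lfunE => /eqP; rewrite scaler_eq0 (negPf c0) => /eqP.
have eqe j : e i h = e j h.
  have [->//|ij] := eqVneq i j.
  have := Ph _ (root_neg ij); rewrite add_lfunE opp_lfunE => /eqP.
  by rewrite subr_eq0 => /eqP.
case: AD => [XA|XD].
  have := e_sum XA h; rewrite (eq_bigr (fun=> e i h)); last by move=> j _.
  rewrite sumr_const card_ord => /eqP; rewrite mulrn_eq0 => /orP[|/eqP//].
  by rewrite XA.
have [j ij] : exists j, i != j.
  have N1 : (1 < N)%N by move: rankP; rewrite XD /=; case: n => [|[|]].
  case: (eqVneq i (Ordinal (ltnW N1))) => [->|];
    last by exists (Ordinal (ltnW N1)).
  by exists (Ordinal N1).
have nA : X <> TypeA by rewrite XD.
have := Ph _ (root_pos nA ij); rewrite add_lfunE -(eqe j) => /eqP.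
by rewrite -mulr2n mulrn_eq0 => /eqP.
Qed.

Lemma finite_roots : finite_set Phi.
Proof.
pose f (t : 'I_N * 'I_N * bool * bool * 'I_3) : 'Hom(T, C) :=
  let: (i, j, u, v, k) := t in
  if k == 0 :> nat then (-1) ^+ u *: e i + (-1) ^+ v *: e j
  else if k == 1 :> nat then (-1) ^+ u *: e i else ((-1) ^+ u * 2%:R) *: e i.
apply: (@sub_finite_set _ _ (f @` setT)); last exact/finite_image/finite_finset.
have fD b : (exists (i j : 'I_N) (u v : bool),
    i != j /\ b = (-1) ^+ u *: e i + (-1) ^+ v *: e j) -> (f @` setT) b.
  by move=> [i [j [u [v [_ ->]]]]]; exists (i, j, u, v, inord 0) => //;
    rewrite /f inordK.
have fB b : (exists (i : 'I_N) (u : bool), b = (-1) ^+ u *: e i) ->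
  (f @` setT) b.
  by move=> [i [u ->]]; exists (i, i, u, u, inord 1) => //; rewrite /f inordK.
have fC b : (exists (i : 'I_N) (u : bool), b = ((-1) ^+ u * 2%:R) *: e i) ->
    (f @` setT) b.
  by move=> [i [u ->]]; exists (i, i, u, u, inord 2) => //; rewrite /f inordK.
move=> b /PhiE; case: X e f fD fB fC => e' f fD fB fC /=; last exact: fD.
- by move=> [i [j [ij ->]]]; apply: fD; exists i, j, false, true;
    rewrite expr0 expr1 scale1r scaleN1r.
- by case; [exact: fD|exact: fB].
- by case; [exact: fD|exact: fC].
Qed.

(** No sign changes in type A, and an even number of them in type D. *)
Definition signs_ok (eps : 'I_N -> bool) :=
  (X = TypeA -> forall k, eps k = false) /\
  (X = TypeD -> \prod_k ((-1) ^+ eps k : C) = 1).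

Lemma signed_root (sigma : {perm 'I_N}) (eps : 'I_N -> bool) b
    (phi : 'Hom(T, C) -> 'Hom(T, C)) :
  (forall b c, phi (b + c) = phi b + phi c) ->
  (forall (k : R[i]) b, phi (k *: b) = k *: phi b) ->
  (X = TypeA -> forall k, eps k = false) ->
  (forall k, phi (e k) = (-1) ^+ eps k *: e (sigma k)) -> Phi b -> Phi (phi b).
Proof.
move=> phiD phiZ epsA phiE /PhiE bP; apply/PhiE.
have fD c : (exists (i j : 'I_N) (u v : bool),
    i != j /\ c = (-1) ^+ u *: e i + (-1) ^+ v *: e j) ->
    exists (i j : 'I_N) (u v : bool),
    i != j /\ phi c = (-1) ^+ u *: e i + (-1) ^+ v *: e j.
  move=> [i [j [u [v [ij ->]]]]].
  exists (sigma i), (sigma j), (u (+) eps i), (v (+) eps j).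
  by rewrite (inj_eq perm_inj) phiD !phiZ !phiE !scalerA !signr_addb.
case: X e sigma eps epsA phiE fD bP => e' sigma eps epsA phiE fD /=;
  last exact: fD.
- move=> [i [j [ij ->]]]; exists (sigma i), (sigma j).
  rewrite (inj_eq perm_inj) -[in LHS]scaleN1r phiD phiZ !phiE !epsA //.
  by rewrite expr0 !scale1r scaleN1r.
- case=> [/fD|[i [u ->]]]; [by left|right].
  by exists (sigma i), (u (+) eps i); rewrite phiZ phiE scalerA signr_addb.
- case=> [/fD|[i [u ->]]]; [by left|right].
  exists (sigma i), (u (+) eps i).
  by rewrite phiZ phiE scalerA signr_addb mulrAC.
Qed.

Definition is_signed_reflection a := exists h0 (sigma : {perm 'I_N}) eps,
  [/\ a h0 = 2%:R, signs_ok eps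
    & forall k, e k - (e k h0 : R[i]) *: a = (-1) ^+ eps k *: e (sigma k)].

(** The reflection exchanges the coordinates i and j, and changes both signs exactly when u = v. The
    vector with coordinates [x] is the coroot; in type A the condition on u and v makes its sum
    0. *)
Lemma signed_reflection_pair (i j : 'I_N) (u v : bool) : i != j ->
  (X = TypeA -> u (+) v) ->
  is_signed_reflection ((-1) ^+ u *: e i + (-1) ^+ v *: e j).
Proof.
move=> ij uvA; have ji : j != i by rewrite eq_sym.
pose x k : C := (-1) ^+ u * (k == i)%:R + (-1) ^+ v * (k == j)%:R.
have signs : u (+) v -> (-1) ^+ u + (-1) ^+ v = 0 :> C.
  by case: (u); case: (v) => //= _; rewrite expr0 expr1 ?addNr ?subrr.
have [h0 h0E] : exists h : T, forall k, e k h = x k.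
  apply: coord_ex => /uvA uv; rewrite big_split /= -!mulr_sumr.
  have sum1 (l : 'I_N) : \sum_k (k == l)%:R = 1 :> C.
    by rewrite (bigD1 l) //= eqxx big1 ?addr0 // => k /negPf ->.
  by rewrite !sum1 !mulr1 signs.
have xi : x i = (-1) ^+ u by rewrite /x eqxx (negPf ij) mulr1 mulr0 addr0.
have xj : x j = (-1) ^+ v by rewrite /x eqxx (negPf ji) mulr1 mulr0 add0r.
exists h0, (tperm i j), (fun k => ((k == i) || (k == j)) && ~~ (u (+) v));
  split.
- rewrite add_lfunE !scale_lfunE !h0E xi xj /GRing.scale /=.
  by rewrite -!signr_addb !addbb.
- split=> [/uvA -> k|_]; first by rewrite andbF.
  case: (u (+) v); first by rewrite big1 // => k _; rewrite andbF.
  rewrite (bigD1 i) // (bigD1 j) //= big1 => [|k /andP[/negPf -> /negPf ->]] //.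
  by rewrite !eqxx orbT /= ?expr1 mulr1 mulrNN mulr1.
- move=> k; rewrite h0E.
  have [->|ki] := eqVneq k i.
    rewrite xi tpermL /= scalerDr !scalerA -!signr_addb addbb scale1r.
    rewrite opprD addrA subrr add0r -scaleNr -signrN.
    by congr (_ ^+ _ *: _); case: (u (+) v).
  have [->|kj] := eqVneq k j.
    rewrite xj tpermR /= scalerDr !scalerA -!signr_addb addbb scale1r addbC.
    rewrite opprD addrCA subrr addr0 -scaleNr -signrN.
    by congr (_ ^+ _ *: _); case: (u (+) v).
  rewrite /x (negPf ki) (negPf kj) !mulr0 addr0 scale0r subr0.
  by rewrite tpermD 1?eq_sym // expr0 scale1r.
Qed.

Lemma signed_reflection_single (i : 'I_N) (c : C) : c != 0 ->
  X <> TypeA -> X <> TypeD -> is_signed_reflection ((c : R[i]) *: e i).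
Proof.
move=> c0 nA nD; pose x k : C := (k == i)%:R * (2%:R / c).
have [h0 h0E] : exists h : T, forall k, e k h = x k by apply: coord_ex.
exists h0, 1%g, (fun k => k == i); split=> //.
- by rewrite scale_lfunE h0E /x eqxx mul1r /GRing.scale /= mulrC divfK.
- move=> k; rewrite h0E /x perm1 scalerA; case: eqVneq => [->|_].
    rewrite mul1r divfK // expr1 scaleN1r.
    by rewrite -[X in X - _]scale1r -scalerBl -scaleN1r; congr (_ *: _); ring.
  by rewrite !mul0r scale0r subr0 expr0 scale1r.
Qed.

Lemma root_signed_reflection a : Phi a -> is_signed_reflection a.
Proof.
move=> /PhiE aP.
have BC : X = TypeB \/ X = TypeC -> forall i (c : C), c != 0 ->
    is_signed_reflection ((c : R[i]) *: e i).
  by move=> XBC i c c0; apply: signed_reflection_single => // XE;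
    case: XBC; rewrite XE.
have pair : X <> TypeA -> (exists (i j : 'I_N) (u v : bool),
    i != j /\ a = (-1) ^+ u *: e i + (-1) ^+ v *: e j) ->
        is_signed_reflection a.
  by move=> nA [i [j [u [v [ij ->]]]]]; exact: signed_reflection_pair.
have pairA : X = TypeA -> (exists i j : 'I_N, i != j /\ a = e i - e j) ->
    is_signed_reflection a.
  move=> XA [i [j [ij ->]]]; rewrite -[e i]scale1r -[- e j]scaleN1r.
  exact: (@signed_reflection_pair i j false true).
have sign0 (u : bool) : (-1) ^+ u != 0 :> C by rewrite signr_eq0.
have single : X = TypeB ->
    (exists (i : 'I_N) (u : bool), a = (-1) ^+ u *: e i) ->
    is_signed_reflection a.
  by move=> XB [i [u ->]]; apply: BC => //; left.
have single2 : X = TypeC ->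
    (exists (i : 'I_N) (u : bool), a = ((-1) ^+ u * 2%:R) *: e i) ->
    is_signed_reflection a.
  move=> XC [i [u ->]]; apply: BC; first by right.
  by rewrite mulf_neq0 // pnatr_eq0.
by case: (classical_root_cases aP) => -[];
  [exact: pairA|exact: pair|exact: single|exact: single2].
Qed.

(** Signed permutations are closed under composition, so reflections suffice. A reflection comes
    with some coroot, which uniqueness identifies with the explicit one. *)
Lemma weyl_signed w : weyl Phi w -> exists (sigma : {perm 'I_N}) eps,
  signs_ok eps /\ forall k h, e k (w h) = (-1) ^+ eps k * e (sigma k) h :> C.
Proof.
elim=> {w} [|a s w Pa [[ha [aha sE]] sPhi] _ [sigma [eps [[epsA epsD] wE]]]].
  exists 1%g, (fun=> false); split=> [|k h].
    by split=> // _; rewrite big1.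
  by rewrite id_lfunE perm1 expr0 mul1r.
have [h0 [tau [del [ah0 [delA delD] tauE]]]] := root_signed_reflection Pa.
have hah0 : ha = h0.
  apply: (coroot_unique finite_roots roots_separate aha ah0) => b Pb.
    have := sPhi b Pb; congr (Phi _); apply/lfunP => h.
    rewrite comp_lfunE sE linearB linearZ /= add_lfunE opp_lfunE scale_lfunE.
    by rewrite /GRing.scale /= mulrC.
  apply: (signed_root (phi := fun b => b - (b h0 : R[i]) *: a)
    _ _ delA tauE Pb).
    by move=> c d; rewrite add_lfunE scalerDl opprD addrACA.
  by move=> k c; rewrite scale_lfunE scalerBr scalerA.
have sE' k h : e k (s h) = (-1) ^+ del k * e (tau k) h :> C.
  have /lfunP/(_ h) := tauE k; rewrite add_lfunE opp_lfunE !scale_lfunE => tauh.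
  rewrite sE hah0 linearB linearZ; apply: etrans tauh.
  by rewrite /GRing.scale /= mulrC.
exists (tau * sigma)%g, (fun k => del k (+) eps (tau k)); split=> [|k h];
  last first.
  by rewrite comp_lfunE sE' wE permM signr_addb mulrA.
split=> [XA k|XD]; first by rewrite delA // epsA.
rewrite (eq_bigr (fun k => (-1) ^+ del k * (-1) ^+ eps (tau k) : C));
  last first.
  by move=> k _; rewrite signr_addb.
rewrite big_split /= delD // mul1r -[RHS](epsD XD).
by rewrite [RHS](reindex_inj (@perm_inj _ tau)).
Qed.

End ClassicalRoots.

End WeylGroup.

(** * Deformation spaces *)

(** Turns an equality of pole orders into conditions at each index that refer beyond it only to the
    fixed irregular type: two maxima agree when the predicates agree wherever nothing larger
    satisfies [P]. *)
Lemma bigmax_ord_eqP s (P P' : pred 'I_s) :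
  (\max_(i < s | P' i) i.+1 = \max_(i < s | P i) i.+1)%N <->
  forall i : 'I_s, (forall j : 'I_s, (i < j)%N -> ~~ P j) -> P' i = P i.
Proof.
split=> [PP' i Pi|PP'].
  have lt_max (U : pred 'I_s) : (forall j : 'I_s, U j -> (j <= i)%N) ->
      ~~ U i -> (\max_(j < s | U j) j.+1 <= i)%N.
    move=> Ui nUi; apply/bigmax_leqP => j Uj; rewrite ltn_neqAle Ui // andbT.
    by apply: contraNneq nUi => /val_inj <-.
  have P_le j : P j -> (j <= i)%N.
    by apply: contraLR; rewrite -ltnNge; exact: Pi.
  have [Pi1|nPi] := boolP (P i).
    apply: contraT => nP'i; have := lt_max P' _ nP'i; rewrite PP' => H.
    have : (i.+1 <= \max_(j < s | P j) j.+1)%N.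
      exact: (@leq_bigmax_cond _ P (fun j : 'I_s => j.+1) i).
    move=> /leq_trans/(_ (H _)); rewrite ltnn; apply => j P'j.
    rewrite -ltnS; apply: (@leq_trans (\max_(j < s | P' j) j.+1)).
      exact: (@leq_bigmax_cond _ P' (fun j : 'I_s => j.+1) j).
    by rewrite PP'; apply/bigmax_leqP => l /P_le.
  apply/negbTE/negP => P'i; have := lt_max P P_le nPi; rewrite -PP'.
  apply/negP; rewrite -ltnNge.
  exact: (@leq_bigmax_cond _ P' (fun j : 'I_s => j.+1) i).
apply/eqP; rewrite eqn_leq; apply/andP; split; apply/bigmax_leqP => i.
  apply: contraTT; rewrite -ltnNge ltnS => /bigmax_leqP Pi.
  have Pn (j : 'I_s) : (i <= j)%N -> ~~ P j.
    by apply: contraTN => /Pi; rewrite -ltnNge.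
  by rewrite PP' ?Pn // => j /ltnW; exact: Pn.
move=> Pi; pose j := [arg max_(j > i | P j) (j : nat)].
have : P j /\ forall l, P l -> (l <= j)%N by rewrite /j; case: arg_maxnP.
move=> [Pj jmax]; apply: (@leq_trans j.+1); first exact: jmax.
apply: (@leq_bigmax_cond _ P' (fun j : 'I_s => j.+1) j); rewrite PP' //.
by move=> l jl; apply: contraTN jl => /jmax; rewrite -leqNgt.
Qed.

Section Zeta.
Variable R : realType.

(** De Moivre's formula. *)
Lemma zeta_expr (t : R) k :
  (cos t +i* sin t) ^+ k = cos (t *+ k) +i* sin (t *+ k).
Proof.
elim: k => [|k IHk]; first by rewrite expr0 mulr0n cos0 sin0.
rewrite exprS IHk mulrS cosD sinD; apply/eqP; rewrite eq_complex /=.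
by rewrite eqxx /= addrC.
Qed.

Lemma zeta_unity r : (0 < r)%N -> (zeta r : R[i]) ^+ r = 1.
Proof.
move=> r_gt0; have -> : (zeta r : R[i]) ^+ r =
  cos (pi *+ 2 : R) +i* sin (pi *+ 2 : R).
  rewrite /zeta zeta_expr -[_ *+ r]mulr_natr divfK ?pnatr_eq0 -?lt0n //.
  by rewrite mulr_natl.
by rewrite cos2pi sin2pi.
Qed.

End Zeta.

(** * Irregular types in standard coordinates *)

Section Classical.
Variables (R : realType) (T : vectType R[i]).
Local Notation C := R[i]^o.
Variables (X : classical_type) (n : nat) (Phi : set 'Hom(T, C)).
Local Notation N := (ncoord X n).
Variable e : 'I_N -> 'Hom(T, C).
Hypotheses (rankP : simple_rank X n)
  (e_sum : X = TypeA -> forall h : T, \sum_i (e i h : R[i]) = 0)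
  (e_coord : forall x : 'I_N -> R[i], (X = TypeA -> \sum_i x i = 0) ->
     exists! h : T, forall i, e i h = x i)
  (PhiE : forall a, Phi a <-> classical_root X e a).
Variable s : nat.
Implicit Types (P Q : irregular_type T s) (i j : 'I_s).

Definition coords Q : cspace R ('I_N * 'I_s) := fun ki => e ki.1 (Q ki.2 : T).

Definition level_coords Q i : cspace R 'I_N := fun k => e k (Q i : T).

Lemma continuous_form (a : 'Hom(T, C)) i :
  continuous (fun Q => a (Q i : T) : C).
Proof.
have ca : continuous (fun h : complex_space T => a h : C).
  apply: (continuous_compose (Y := prod_topology (fun _ : 'Hom(T, C) => C))
    (@initial_continuous _ _ _) (@continuous_proj _ _ a)).
exact: (continuous_compose (@continuous_proj _ _ i) ca).
Qed.

Lemma continuous_coords : continuous coords.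
Proof.
by apply: continuous_prod_topology => -[k i]; exact: continuous_form.
Qed.

(* In type A the dual vectors are projected to the hyperplane of sum 0. *)
Lemma coords_inverse : exists f : cspace R ('I_N * 'I_s) -> irregular_type T s,
  [/\ continuous f, forall Q, f (coords Q) = Q
    & forall x, (X = TypeA -> forall i, \sum_k x (k, i) = 0) ->
        coords (f x) = x].
Proof.
pose d : C := if X is TypeA then N%:R^-1 else 0.
have dA : X = TypeA -> d = N%:R^-1 by rewrite /d; case: (X).
have dn : X <> TypeA -> d = 0 by rewrite /d; case: (X).
have /choice[v vE] (k : 'I_N) : exists h : T, forall l, e l h = (l == k)%:R - d.
  apply: (coord_ex e_coord) => XA;
    rewrite big_split /= sumrN sumr_const card_ord.
  rewrite (bigD1 k) //= eqxx big1 => [|l /negPf -> //].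
  have N0 : N%:R != 0 :> C by rewrite pnatr_eq0; case: (N) k => [[]|].
  by rewrite dA // -(mulr_natl N%:R^-1) divff // addr0 subrr.
pose f (x : cspace R ('I_N * 'I_s)) : irregular_type T s :=
  fun i => \sum_k (x (k, i) : R[i]) *: v k.
have fE x : (X = TypeA -> forall i, \sum_k x (k, i) = 0) -> coords (f x) = x.
  move=> xs; apply/funext => -[l i]; rewrite /coords /f /= linear_sum /=.
  rewrite (eq_bigr (fun k => x (k, i) * (l == k)%:R - x (k, i) * d));
    last first.
    by move=> k _; rewrite linearZ /= vE -mulrBr.
  rewrite big_split /= sumrN -mulr_suml (bigD1 l) //= eqxx mulr1 big1;
    last first.
    by move=> k kl; rewrite eq_sym (negPf kl) mulr0.
  rewrite addr0 (_ : _ * d = 0) ?subr0 //.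
  have [XA|nA] := pselect (X = TypeA); first by rewrite xs // mul0r.
  by rewrite dn // mulr0.
exists f; split=> //.
- apply: continuous_prod_topology => i; apply: continuous_comp_initial.
  apply: continuous_prod_topology => a.
  rewrite (_ : (fun x => _) = fun x : cspace R ('I_N * 'I_s) =>
      \sum_k (a (v k) : C) * x (k, i)); last first.
    apply/funext => x; rewrite /= /f linear_sum; apply: eq_bigr => k _.
    by rewrite linearZ mulrC.
  apply: continuous_sum => k; apply: continuous_scale; exact: continuous_coord.
- move=> Q; apply: functional_extensionality_dep => i.
  apply: (coord_inj e_sum e_coord) => k.
  have sQ : X = TypeA -> forall j, \sum_l coords Q (l, j) = 0.
    by move=> XA j; exact: (e_sum XA (Q j : T)).
  exact: (congr1 (fun x => x (k, i)) (fE _ sQ)).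
Qed.

Lemma pole_orderP (a : 'Hom(T, C)) P Q : pole_order a P = pole_order a Q <->
  forall i, (forall j, (i < j)%N -> a (Q j : T) = 0) ->
    a (P i : T) = 0 <-> a (Q i : T) = 0.
Proof.
rewrite /pole_order; split.
  move=> /(bigmax_ord_eqP (fun i => a (Q i : T) != 0)
    (fun i => a (P i : T) != 0)).
  move=> H i Qi; have /H/negb_inj E : forall j, (i < j)%N ->
    ~~ (a (Q j : T) != 0).
    by move=> j /Qi ->; rewrite eqxx.
  by split=> /eqP; [rewrite E|rewrite -E] => /eqP.
move=> H; apply/(bigmax_ord_eqP (fun i => a (Q i : T) != 0)
  (fun i => a (P i : T) != 0)) => i Qi.
have E : a (P i : T) = 0 <-> a (Q i : T) = 0.
  by apply: H => j /Qi; rewrite negbK => /eqP.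
by congr (~~ _); apply/eqP/eqP => /E.
Qed.

(** The kernel of a root is given by e_k = e_l, by e_k = - e_l outside type A, or by e_k = 0 in
    types B and C. *)
Lemma pole_conditions P Q :
  (forall a, Phi a -> pole_order a P = pole_order a Q) <->
  (forall i k l (t : bool), k != l -> (X = TypeA -> t = false) ->
     (forall j, (i < j)%N -> level_coords Q j k =
         (-1) ^+ t * level_coords Q j l) ->
     level_coords P i k = (-1) ^+ t * level_coords P i l <->
     level_coords Q i k = (-1) ^+ t * level_coords Q i l) /\
  (X = TypeB \/ X = TypeC -> forall i k,
     (forall j, (i < j)%N -> level_coords Q j k = 0) ->
     level_coords P i k = 0 <-> level_coords Q i k = 0).
Proof.
rewrite /level_coords; split=> [PQ|[pair single] a /PhiE aP].
  split=> [i k l t kl tA|BC i k].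
    have [a Pa aE] : exists2 a, Phi a &
        forall h, a h = 0 <-> e k h = (-1) ^+ t * e l h :> C.
      case: t tA => tA.
        exists (e k + e l); first by apply: (root_pos PhiE) kl => /tA.
        move=> h; rewrite add_lfunE expr1 mulN1r.
        by split=> [/eqP|->]; [rewrite addr_eq0 => /eqP|rewrite addNr].
      exists (e k - e l); first exact: (root_neg PhiE).
      move=> h; rewrite add_lfunE opp_lfunE expr0 mul1r.
      by split=> [/eqP|->]; [rewrite subr_eq0 => /eqP|rewrite subrr].
    move=> Qj; rewrite -!aE; have /pole_orderP aPQ := PQ a Pa.
    by apply: aPQ => j ij; apply/aE/Qj.
  have [c c0 Pc] := root_single PhiE k BC.
  have cE h : ((c : R[i]) *: e k) h = 0 <-> e k h = 0.
    rewrite scale_lfunE; split=> [/eqP|->]; last by rewrite scaler0.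
    by rewrite scaler_eq0 (negPf c0) => /eqP.
  move=> Qj; rewrite -!cE; have /pole_orderP cPQ := PQ _ Pc.
  by apply: cPQ => j ij; apply/cE/Qj.
have pairP k l (t : bool) : k != l -> (X = TypeA -> t = false) ->
    (forall h, a h = 0 <-> e k h = (-1) ^+ t * e l h :> C) ->
    pole_order a P = pole_order a Q.
  move=> kl tA aE; apply/pole_orderP => i Qj; rewrite !aE.
  by apply: pair => // j ij; apply/aE/Qj.
have singleP k : X = TypeB \/ X = TypeC -> (forall h, a h = 0 <-> e k h = 0) ->
    pole_order a P = pole_order a Q.
  move=> BC aE; apply/pole_orderP => i Qj; rewrite !aE.
  by apply: single => // j ij; apply/aE/Qj.
have [[XA [k [l [kl aE]]]]|[nA [k [l [u [v [kl aE]]]]]]|[XB [k [u aE]]]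
  |[XC [k [u aE]]]] := classical_root_cases aP.
- apply: (pairP k l false) => // h; rewrite aE add_lfunE opp_lfunE expr0 mul1r.
  by split=> [/eqP|->]; [rewrite subr_eq0 => /eqP|rewrite subrr].
- apply: (pairP k l (~~ (u (+) v))) => // h.
  rewrite aE add_lfunE !scale_lfunE /GRing.scale /= signrN signr_addb mulNr.
  have -> : (-1) ^+ u * e k h + (-1) ^+ v * e l h =
      (-1) ^+ u * (e k h + (-1) ^+ u * (-1) ^+ v * e l h) :> C.
    by rewrite mulrDr -mulrA signrMK.
  split=> [/eqP|->]; last by rewrite addNr mulr0.
  by rewrite mulf_eq0 signr_eq0 /= addr_eq0 => /eqP.
- apply: (singleP k) => [|h]; first by left.
  rewrite aE scale_lfunE; split=> [/eqP|->]; last by rewrite scaler0.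
  by rewrite scaler_eq0 signr_eq0 => /eqP.
- apply: (singleP k) => [|h]; first by right.
  rewrite aE scale_lfunE; split=> [/eqP|->]; last by rewrite scaler0.
  by rewrite scaler_eq0 mulf_eq0 signr_eq0 pnatr_eq0 => /eqP.
Qed.

Variable r : nat.
Hypothesis r_gt0 : (0 < r)%N.

(** The ordinal [i] indexes the coefficient of w to the power -(i + 1). *)
Definition zeta_level i : C := (zeta r : R[i]) ^+ i.+1.

Lemma zeta_level_unity i : zeta_level i ^+ r = 1.
Proof. by rewrite /zeta_level -exprM mulnC exprM zeta_unity // expr1n. Qed.

Lemma generates_orbitP w (sigma : {perm 'I_N}) (eps : 'I_N -> bool) Q :
  weyl Phi w ->
  (forall k h, e k (w h) = (-1) ^+ eps k * e (sigma k) h :> C) ->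
  generates_orbit Phi r w Q <->
  forall i, equivariant sigma eps [set: 'I_N] (zeta_level i) (level_coords Q i).
Proof.
move=> Ww wE; rewrite /level_coords; split=> [[_ wQ] i k _|wQ].
  by rewrite -wE wQ linearZ.
split=> // i; apply: (coord_inj e_sum e_coord) => k.
by rewrite wE -wQ ?inE // linearZ.
Qed.

(** * The deformation space of a fixed irregular type *)

Section Deformation.
Variables (Q : irregular_type T s) (w : 'End(T)) (sigma : {perm 'I_N})
  (eps : 'I_N -> bool).
Hypotheses (Ww : weyl Phi w)
  (wE : forall k h, e k (w h) = (-1) ^+ eps k * e (sigma k) h :> C)
  (eps_ok : signs_ok R eps)
  (wQ : generates_orbit Phi r w Q).

Let q i := level_coords Q i.

Let qE i : equivariant sigma eps [set: 'I_N] (zeta_level i) (q i).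
Proof. exact: (proj1 (generates_orbitP Q Ww wE)). Qed.

(* An element of Gamma sends Q_b to a polar part which agrees with Q_a beyond
   w^(-i), and it acts on the coefficient of w^(-i) as [c]. *)
Definition link i (a b : 'I_N) (c : C) := exists k (u : bool),
  [/\ X = TypeA -> u = false, c = (-1) ^+ u * zeta_level i ^+ k
    & forall j, (i < j)%N -> q j a = (-1) ^+ u * zeta_level j ^+ k * q j b].

Lemma link_refl i a : link i a a 1.
Proof.
by exists 0%N, false; split=> // [|j _]; rewrite !expr0 ?mul1r.
Qed.

(** Since the r-th power is 1, inverses are natural powers, with an exponent that does not depend on
    the level. *)
Lemma zeta_level_inv i k : zeta_level i ^+ (k * r.-1) = (zeta_level i ^+ k)^-1.
Proof.
have zk : zeta_level i ^+ (k * r.-1) * zeta_level i ^+ k = 1.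
  by rewrite -exprD -mulnSr prednK // mulnC exprM zeta_level_unity expr1n.
apply/eqP; rewrite -[_^-1]mul1r -zk mulfK //.
by apply: contra_eq_neq zk => ->; rewrite mulr0 eq_sym oner_eq0.
Qed.

Lemma zeta_level_neq0 i k : zeta_level i ^+ k != 0.
Proof.
apply: expf_neq0; apply: contra_eq_neq (zeta_level_unity i) => ->.
by rewrite expr0n gtn_eqF // eq_sym oner_eq0.
Qed.

Lemma sign_zeta_neq0 i (u : bool) k : (-1) ^+ u * zeta_level i ^+ k != 0 :> C.
Proof. by rewrite mulf_neq0 ?signr_eq0 ?zeta_level_neq0. Qed.

Lemma sign_zeta_inv i (u : bool) k :
  (-1) ^+ u * zeta_level i ^+ (k * r.-1) =
      ((-1) ^+ u * zeta_level i ^+ k)^-1 :> C.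
Proof. by rewrite zeta_level_inv invfM invr_sign. Qed.

Lemma link_sym i a b c : link i a b c -> link i b a c^-1.
Proof.
move=> [k [u [uA -> qab]]]; exists (k * r.-1)%N, u; split=> //.
  by rewrite sign_zeta_inv.
by move=> j /qab ->; rewrite sign_zeta_inv mulKf ?sign_zeta_neq0.
Qed.

Lemma link_trans i a b d c c' : link i a b c -> link i b d c' ->
  link i a d (c * c').
Proof.
move=> [k [u [uA -> qab]]] [l [v [vA -> qbd]]]; exists (k + l)%N, (u (+) v).
split; first by move=> XA; rewrite uA // vA.
  by rewrite signr_addb exprD mulrACA.
move=> j ij; rewrite qab // qbd // signr_addb exprD mulrA.
by rewrite [X in X * _]mulrACA.
Qed.

Lemma link_unity i a c : link i a a c -> c ^+ (2 * r) = 1.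
Proof.
move=> [k [u [_ -> _]]]; rewrite exprMn [X in X * _]exprM sqrr_sign expr1n
  mul1r.
by rewrite -exprM mulnA mulnC exprM zeta_level_unity expr1n.
Qed.

Definition zero_class i : {set 'I_N} :=
  [set a | [forall j : 'I_s, (i < j)%N ==> (q j a == 0)]]%SET.

Lemma zero_classP i a :
  reflect (forall j, (i < j)%N -> q j a = 0) (a \in zero_class i).
Proof.
rewrite inE; apply: (iffP forallP) => H j; last by apply/implyP => /H ->.
by move=> ij; have /implyP/(_ ij)/eqP := H j.
Qed.

Lemma link_zero_class i a b c : link i a b c ->
  (a \in zero_class i) = (b \in zero_class i).
Proof.
have H d d' c' : link i d d' c' -> d' \in zero_class i -> d \in zero_class i.
  move=> [k [u [_ _ qd]]] /zero_classP qd'; apply/zero_classP => j ij.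
  by rewrite qd // qd' // mulr0.
by move=> Gab; apply/idP/idP; [exact: H (link_sym Gab)|exact: H Gab].
Qed.

Lemma link_sigma i a : link i (sigma a) a ((-1) ^+ eps a * zeta_level i).
Proof.
exists 1%N, (eps a); split=> [XA|//|j _]; first by rewrite eps_ok.1.
by rewrite expr1 (equivariant_sigma (qE j)) ?inE.
Qed.

Definition level i : set (cspace R 'I_N) :=
  [set x | [/\ X = TypeA -> \sum_k x k = 0,
      X <> TypeD -> forall a b c, link i a b c ->
        x a = c * x b <-> q i a = c * q i b
    & X = TypeD -> level_space (q i) (link i) (zero_class i)
        (signed_space sigma eps (zero_class i) (q i) (zeta_level i)) x]].

Lemma sigma_zero_class i a : a \in zero_class i -> sigma a \in zero_class i.
Proof. by rewrite (link_zero_class (link_sigma i a)). Qed.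

Lemma arranged_level_i i : arranged R (X = TypeD) (set_type (level i)).
Proof.
have r2 : (0 < 2 * r)%N by rewrite muln_gt0.
have [XA|nA] := pselect (X = TypeA).
  have nD : X <> TypeD by rewrite XA.
  rewrite (_ : level i = [set x : cspace R 'I_N | \sum_a x a = 0 /\
     forall a b c, link i a b c -> x a = c * x b <-> q i a = c * q i b]).
    have a0 : 'I_N by rewrite XA; exact: ord0.
    apply: (arranged_sum0_level r2 (@link_refl i) (@link_sym i) (@link_trans i)
      (@link_unity i) (sigma := sigma) (z := zeta_level i)) => //.
    - by move=> a; have := link_sigma i a; rewrite eps_ok.1 // mul1r.
    - move=> a; rewrite (equivariant_sigma (qE i)) ?inE // eps_ok.1 //.
      by rewrite mul1r.
    - by move=> z1 a b c [k [u [/(_ XA) -> -> _]]]; rewrite z1 expr1n mul1r.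
  apply/predeqP => x; split=> [[xs xl _]|[xs xl]].
    by split; [exact: xs|exact: xl].
  by split=> // /nD.
have [XD|nD] := pselect (X = TypeD); last first.
  rewrite (_ : level i = [set x : cspace R 'I_N |
     forall a b c, link i a b c -> x a = c * x b <-> q i a = c * q i b]).
    exact: (arranged_full_level (q i) r2 (@link_refl i) (@link_sym i)
      (@link_trans i) (@link_unity i)).
  apply/predeqP => x; split=> [[_ xl _]|xl]; first exact: xl.
  by split=> // [/nA|_|/nD].
rewrite (_ : level i = level_space (q i) (link i) (zero_class i)
        (signed_space sigma eps (zero_class i) (q i) (zeta_level i))).
  apply: (arranged_level (q i) r2 (@link_refl i) (@link_sym i) (@link_trans i)
      (@link_unity i) (@link_zero_class i)).
    move=> x y xy [xE xq]; split=> [a aZ|a b u aZ bZ].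
      by rewrite -!xy ?sigma_zero_class //; exact: xE.
    by rewrite -!xy //; exact: xq.
  apply: (arranged_signed_space (@sigma_zero_class i) r_gt0
    (zeta_level_unity i)) => //.
  by move=> a _; apply: qE; rewrite inE.
apply/predeqP => x; split=> [[_ _ xl]|xl]; first exact: xl.
by split=> // [/nA|].
Qed.

(** Equivariance rewrites the power of zeta at [b] as a sign at another index [d]. The relation then
    becomes the pole order condition for [a] and [d], or, if a = d with sign -1, the vanishing of
    the coordinate at [a]. *)
Lemma link_iff (P : irregular_type T s) (tau : {perm 'I_N})
    (del : 'I_N -> bool) :
  signs_ok R del ->
  (forall i, equivariant tau del [set: 'I_N] (zeta_level i) (q i)) ->
  (forall i, equivariant tau del [set: 'I_N]
      (zeta_level i) (level_coords P i)) ->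
  (forall i k l (t : bool), k != l -> (X = TypeA -> t = false) ->
     (forall j, (i < j)%N -> q j k = (-1) ^+ t * q j l) ->
     level_coords P i k = (-1) ^+ t * level_coords P i l <->
     q i k = (-1) ^+ t * q i l) ->
  forall i a b c, link i a b c ->
  (X <> TypeA -> (forall j, (i < j)%N -> q j a = 0) ->
     level_coords P i a = 0 <-> q i a = 0) ->
  level_coords P i a = c * level_coords P i b <-> q i a = c * q i b.
Proof.
move=> del_ok qT PT pair i a b c [k [u [uA -> qab]]] single.
have bT : b \in [set: 'I_N]%SET by rewrite inE.
have tauT a' : a' \in [set: 'I_N]%SET ->
  tau a' \in [set: 'I_N]%SET by rewrite !inE.
have [d [v [_ vA bd]]] := @equivariant_iter R _ tau del [set: 'I_N] k b tauT bT.
have uvA : X = TypeA -> u (+) v = false.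
  by move=> XA; rewrite uA // vA //; exact: del_ok.1.
rewrite -!mulrA (bd _ _ (PT i)) (bd _ _ (qT i)) !mulrA -!signr_addb.
have qad j : (i < j)%N -> q j a = (-1) ^+ (u (+) v) * q j d.
  by move=> /qab ->; rewrite -mulrA (bd _ _ (qT j)) mulrA signr_addb.
have [ad|] := eqVneq a d; last by move=> ad; exact: pair.
rewrite -ad; case: (u (+) v) uvA qad => uvA qad; last by rewrite expr0 !mul1r.
rewrite expr1 !mulN1r !oppr_fixed; apply: single => [/uvA//|j /qad].
by rewrite -ad expr1 mulN1r => /oppr_fixed.
Qed.

(* Both signed permutations act in the same way on [Q], and the conditions on
   pairs of indices transfer this to [P] except where the permutations agree
   and the signs differ. There [Q] vanishes; as both sign vectors have product
   1, it vanishes at a second index, and hence [P] vanishes at both. *)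
Lemma equivariant_independent (P : irregular_type T s) (tau : {perm 'I_N})
    (del : 'I_N -> bool) : X = TypeD -> signs_ok R del ->
  (forall i, equivariant tau del [set: 'I_N] (zeta_level i) (q i)) ->
  (forall i, equivariant tau del [set: 'I_N]
      (zeta_level i) (level_coords P i)) ->
  (forall i k l (t : bool), k != l -> (X = TypeA -> t = false) ->
     (forall j, (i < j)%N -> q j k = (-1) ^+ t * q j l) ->
     level_coords P i k = (-1) ^+ t * level_coords P i l <->
     q i k = (-1) ^+ t * q i l) ->
  forall i, equivariant sigma eps [set: 'I_N] (zeta_level i) (level_coords P i).
Proof.
move=> XD del_ok qT PT pair.
have nA : X <> TypeA by rewrite XD.
have pair0 k l (t : bool) : k != l -> (forall j, q j k = (-1) ^+ t * q j l) ->
    forall i, level_coords P i k = (-1) ^+ t * level_coords P i l.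
  by move=> kl qkl i; apply/pair.
suff sigma_tau a i : level_coords P i (sigma a) =
    (-1) ^+ (eps a (+) del a) * level_coords P i (tau a).
  by move=> i a aT; rewrite PT // sigma_tau signr_addb -mulrA signrMK.
have q_tau j a' : q j (sigma a') = (-1) ^+ (eps a' (+) del a') * q j (tau a').
  rewrite (equivariant_sigma (qE j)) ?inE // (equivariant_sigma (qT j)) ?inE //.
  by rewrite signr_addb -!mulrA signrMK.
have [ab|ab] := eqVneq (sigma a) (tau a); last exact: pair0 ab _ _.
have [|neq_sign] := boolP (~~ (eps a (+) del a)).
  by move=> /negPf ->; rewrite ab expr0 mul1r.
rewrite negbK in neq_sign.
have q0 j : q j (sigma a) = 0.
  by apply/oppr_fixed; rewrite {1}q_tau neq_sign ab expr1 mulN1r.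
have [d [dna qd]] : exists d, d != sigma a /\ forall j, q j d = 0.
  apply: contrapT => no_d.
  (* [F k] is a non-zero coefficient of Q_k, at a level depending only on which coefficients vanish;
     hence [F] at [sigma k] and at [tau k] uses the same level. *)
  pose F (k : 'I_N) : C :=
    if [pick j | q j k != 0] is Some j then q j k else 0.
  have F0 k : k != sigma a -> F k != 0.
    move=> ka; rewrite /F; case: pickP => // qk; case: no_d; exists k;
      split=> // j.
    by have /eqP := qk j.
  have F_sign k : F (sigma k) = (-1) ^+ (eps k (+) del k) * F (tau k).
    rewrite /F (eq_pick (Q := fun j => q j (tau k) != 0)); last first.
      by move=> j /=; rewrite q_tau mulf_eq0 signr_eq0.
    by case: pickP => [j _|_]; rewrite ?mulr0 // q_tau.
  have prodF (rho : {perm 'I_N}) : rho a = sigma a ->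
      \prod_(k | k != a) F (rho k) = \prod_(k | k != sigma a) F k.
    move=> ra; rewrite [RHS](reindex_inj (@perm_inj _ rho)) /=.
    by apply: eq_bigl => k; rewrite -ra (inj_eq perm_inj).
  have prod_neq0 : \prod_(k | k != sigma a) F k != 0 by apply/prodf_neq0.
  (* Both permutations send the complement of [a] onto that of [sigma a], where [F] has a non-zero
     product; so the sign discrepancies away from [a] multiply to 1, whereas the one at [a] is
     -1. *)
  have prod1 : \prod_(k | k != a) (-1) ^+ (eps k (+) del k) = 1 :> C.
    apply: (mulIf prod_neq0); rewrite mul1r -{1}(prodF tau) // -big_split /=.
    by rewrite -(prodF sigma) //; apply: eq_bigr => k _; rewrite F_sign.
  have prodT : \prod_k (-1) ^+ (eps k (+) del k) = 1 :> C.
    under eq_bigr do rewrite signr_addb.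
    by rewrite big_split /= eps_ok.2 // del_ok.2 // mulr1.
  move: prodT; rewrite (bigD1 a) //= prod1 mulr1 neq_sign expr1 => /eqP.
  by rewrite eq_sym -addr_eq0 -mulr2n pnatr_eq0.
have zero_sigma : level_coords P i (sigma a) = 0.
  have da (t : bool) : level_coords P i (sigma a) =
    (-1) ^+ t * level_coords P i d.
    by apply: pair0 => [|j]; rewrite ?q0 ?qd ?mulr0 // eq_sym.
  by apply/oppr_fixed; rewrite {1}(da true) (da false) expr1 expr0 mulN1r mul1r.
by rewrite -ab zero_sigma mulr0.
Qed.

(** From left to right, the common generator is arbitrary, and in type D it is first replaced by the
    fixed one. From right to left, the relations between [sigma a] and [a] show that the fixed
    generator works for [P], and links with exponent 0 give the pole orders. *)
Lemma deformation_levels P : deformation_space Phi r Q P <->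
  forall i, level i (level_coords P i).
Proof.
have XC : X = TypeA \/ (X = TypeB \/ X = TypeC) \/ X = TypeD.
  by case: (X); tauto.
split=> [[[w' [w'P w'Q]] /pole_conditions[pair single]] i|lev].
  have [tau [del [del_ok w'E]]] := weyl_signed rankP e_sum e_coord PhiE w'P.1.
  have PT := proj1 (generates_orbitP P w'P.1 w'E) w'P.
  have qT := proj1 (generates_orbitP Q w'P.1 w'E) w'Q.
  split=> [XA|nD a b c Gab|XD].
  - exact: (e_sum XA (P i : T)).
  - apply: (link_iff del_ok qT PT pair Gab) => nA qa; apply: single => //.
    by case: XC => [/nA|[|/nD]].
  - have PE := equivariant_independent XD del_ok qT PT pair.
    split; first split.
    + by move=> a _; apply: PE; rewrite inE.
    + move=> a b u /zero_classP aZ /zero_classP bZ ab; apply: pair => //.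
        by rewrite XD.
      by move=> j ij; rewrite -/(q j) aZ // bZ // mulr0.
    + move=> a b c aZ _ Gab; apply: (link_iff del_ok qT PT pair Gab) => _ qa.
      by case/negP: aZ; apply/zero_classP.
have linkP i a b c : link i a b c -> X <> TypeD ->
    level_coords P i a = c * level_coords P i b <-> q i a = c * q i b.
  by move=> Gab nD; have [_ H _] := lev i; exact: H.
have PT i : equivariant sigma eps [set: 'I_N] (zeta_level i) (level_coords P i).
  move=> a _; suff -> : level_coords P i (sigma a) =
      (-1) ^+ eps a * zeta_level i * level_coords P i a.
    by rewrite -mulrA signrMK.
  have Ga := link_sigma i a.
  have qa : q i (sigma a) = (-1) ^+ eps a * zeta_level i * q i a.
    by rewrite (equivariant_sigma (qE i)) ?inE.
  have [XD|nD] := pselect (X = TypeD); last exact/(linkP _ _ _ _ Ga nD).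
  have [_ _ /(_ XD)[[xE _] xl]] := lev i.
  have [aZ|aZ] := boolP (a \in zero_class i).
    by rewrite (equivariant_sigma xE).
  by apply/(xl _ _ _ _ _ Ga) => //; rewrite (link_zero_class Ga).
split; first by exists w; split=> //; apply/(generates_orbitP P Ww wE).
apply/pole_conditions; split=> [i k l t kl tA qkl|XBC i k qk].
  have Gkl : link i k l ((-1) ^+ t).
    exists 0%N, t; split=> // [|j ij]; first by rewrite expr0 mulr1.
    by rewrite expr0 mulr1; exact: qkl.
  have [XD|nD] := pselect (X = TypeD); last exact: linkP.
  have [_ _ /(_ XD)[[_ xq] xl]] := lev i.
  have [kZ|kZ] := boolP (k \in zero_class i).
    by apply: xq => //; rewrite -(link_zero_class Gkl).
  by apply: xl => //; rewrite -(link_zero_class Gkl).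
have nD : X <> TypeD by case: XBC => ->.
(* In types B and C, an index whose polar part vanishes beyond the level is linked to itself by -1,
   which encodes the vanishing of its coordinate. *)
have Gkk : link i k k (-1).
  exists 0%N, true; split=> [|//|j ij].
  - by case: XBC => ->.
  - by rewrite expr0 mulr1.
  - by rewrite /q qk // mulr0.
by have := linkP _ _ _ _ Gkk nD; rewrite !mulN1r !oppr_fixed.
Qed.

Lemma arranged_deformation :
  arranged R (X = TypeD) (set_type (deformation_space Phi r Q)).
Proof.
have [f [cf fK Kf]] := coords_inverse.
apply: arranged_homeo (arranged_levels arranged_level_i).
apply: (homeomorphic_sets continuous_coords cf) => //.
- by move=> P /deformation_levels.
- move=> x lev; apply/deformation_levels => i.
  have sx : X = TypeA -> forall j, \sum_k x (k, j) = 0.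
    by move=> XA j; have [/(_ XA)] := lev j.
  have -> : level_coords (f x) i = fun a => x (a, i); last exact: lev.
  by apply/funext => k; have := congr1 (fun y => y (k, i)) (Kf x sx).
- move=> x lev; apply: Kf => XA j.
  by have [/(_ XA)] := lev j.
Qed.

End Deformation.

End Classical.

Theorem theorem1p3p4 (R : realType) (g : vectType R[i]) (br : g -> g -> g)
  (t : {vspace g}) (X : classical_type) (n : nat)
  (br_lie : lie_bracket br) (br_simple : lie_simple br)
  (t_cartan : cartan_subalgebra br t)
  (g_classical : of_classical_type X n (lie_roots br t))
  (r : nat) (r_gt0 : (0 < r)%N) (s : nat)
  (Q : irregular_type (subvs_of t) s)
  (Q_closed : galois_closed (lie_roots br t) r Q) :
  exists mu mu_sharp mu_sharp2 : posnat -> posnat -> nat,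
    [/\ [/\ finitely_supported mu, finitely_supported mu_sharp
          & finitely_supported mu_sharp2],
        homeomorphic
          (set_type (deformation_space (lie_roots br t) r Q))
          (arrangement_product R mu mu_sharp mu_sharp2)
      & (exists k k', mu_sharp2 k k' <> 0%N) -> X = TypeD].
Proof.
have [rankP [e [e_sum e_coord PhiE]]] := g_classical.
have [w wQ] := Q_closed.
have [sigma [eps [eps_ok wE]]] := weyl_signed rankP e_sum e_coord PhiE wQ.1.
exact: (arranged_deformation rankP e_sum e_coord PhiE r_gt0 wQ.1 wE eps_ok wQ).
Qed.
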